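(* Let $\mathcal{P}\subsetneq\mathcal{N}$, $\emptyset\neq\mathcal{Q}\subsetneq\mathcal{N}\setminus\mathcal{P}$, $\mathcal{R}=\mathcal{Q}\cup\mathcal{P}$, and let $\{\mathcal{Q}_j\}_{j\in\mathbb{J}}$ be a partition of $\mathcal{N}\setminus\mathcal{R}$ into nonempty pairwise disjoint sets; put $\mathcal{R}_j=\mathcal{Q}_j\cup\mathcal{P}$. Assume that for each $j\in\mathbb{J}$ every optimal plan $\tau$ of the reduced problem $(\mathrm{RMKP}_{\mathcal{R}_j})$ is concentrated on the graph of a measurable map from $\prod_{k\in\mathcal{P}}X_k$ to $\prod_{k\in\mathcal{Q}_j}X_k$, i.e. $\tau=(\mathrm{id}\times T)\#(\pi_\mathcal{P}\#\tau)$ for some measurable $T$. Let $\lambda$ be an optimal plan of (MKP), $\lambda_\mathcal{R}=\pi_\mathcal{R}\#\lambda$, $\lambda_\mathcal{P}$ and $\lambda_\mathcal{Q}$ its marginals on $\prod_{k\in\mathcal{P}}X_k$ and $\prod_{k\in\mathcal{Q}}X_k$, and let $\lambda_\mathcal{R}=\lambda^{(x_k)_{k\in\mathcal{P}}}_\mathcal{Q}\otimes\lambda_\mathcal{P}$ be the disintegration of $\lambda_\mathcal{R}$ with respect to $\lambda_\mathcal{P}$, with $\lambda^{(x_k)_{k\in\mathcal{P}}}_\mathcal{Q}\in P(\prod_{k\in\mathcal{Q}}X_k)$. Then there are measurable maps $T_{\mathcal{Q}_j}:\prod_{k\in\mathcal{P}}X_k\to\prod_{k\in\mathcal{Q}_j}X_k$,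 $j\in\mathbb{J}$, such that (up to the obvious rearrangement of coordinates) $$\lambda=\Big(\prod_{j\in\mathbb{J}}\delta_{T_{\mathcal{Q}_j}((x_k)_{k\in\mathcal{P}})}\times\lambda_\mathcal{Q}^{(x_k)_{k\in\mathcal{P}}}\Big)\otimes\lambda_\mathcal{P}.$$ Moreover, if $(\mathrm{RMKP}_\mathcal{R})$ and all $(\mathrm{RMKP}_{\mathcal{R}_j})$, $j\in\mathbb{J}$, have unique solutions, then (MKP) has a unique optimal plan.
   Context: Let $N\ge 3$, $\mathcal{N}=\{1,\ldots,N\}$, $\mu_k$ Borel probability measures on complete separable metric spaces $X_k$; $\Pi((\mu_k)_{k\in\mathcal{S}})$ denotes Borel probability measures on $\prod_{k\in\mathcal{S}}X_k$ with marginals $\mu_k$; all index sets are ordered increasingly. The cost $c:\prod_{k\in\mathcal{N}}X_k\to\mathbb{R}$ is lower semicontinuous with $c\ge\sum_ka_k(x_k)$, $a_k\in L_1(\mu_k)$. (MKP) is $\inf\{\int c\,d\lambda:\lambda\in\Pi((\mu_k)_{k\in\mathcal{N}})\}$, assumed attained (minimizers = optimal plans). $(\varphi_k)_{k\in\mathcal{N}}$ is a fixed solution of the dual problem $\sup\{\sum_k\int\varphi_kd\mu_k:\varphi_k\in L_1(\mu_k),\sum_k\varphi_k(x_k)\le c\}$. For $\mathcal{S}\subsetneq\mathcal{N}$, $c_\mathcal{S}((x_k)_{k\in\mathcal{S}})=\inf_{(x_k)_{k\in\mathcal{N}\setminus\mathcal{S}}}\{c((x_k)_{k\in\mathcal{N}})-\sum_{k\in\mathcal{N}\setminus\mathcal{S}}\varphi_k(x_k)\}$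 and $(\mathrm{RMKP}_\mathcal{S})$ is $\inf\{\int c_\mathcal{S}d\tau:\tau\in\Pi((\mu_k)_{k\in\mathcal{S}})\}$. $\pi_\mathcal{S}$ denotes the canonical projection onto $\prod_{k\in\mathcal{S}}X_k$. For a measure $\sigma$ on $A$ and a measurable family $(\eta^a)_{a\in A}$ of probability measures on $B$, $\eta^a\otimes\sigma$ is the measure on $A\times B$ given by $(\eta^a\otimes\sigma)(E\times F)=\int_E\eta^a(F)\,d\sigma(a)$; $\delta_y$ is the Dirac mass at $y$. *)

(* Defs.v *)
From HB Require Import structures.
From mathcomp Require Import all_boot all_order all_algebra.
From mathcomp Require Import all_classical all_reals all_analysis.
Import Order.TTheory GRing.Theory Num.Theory.
Local Open Scope classical_set_scope.
Local Open Scope ring_scope.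

Definition separable_space (T : topologicalType) :=
  exists D : set T, countable D /\ closure D = setT.

Definition borel (T : ptopologicalType) := g_sigma_algebraType (@open T).

Definition sidx {N : nat} (S : {set 'I_N}) := {k : 'I_N | k \in S}.

Definition prodS {N : nat} (X : 'I_N -> Type) (S : {set 'I_N}) :=
  forall k : sidx S, X (sval k).

HB.instance Definition _ {N : nat} (X : 'I_N -> pointedType) (S : {set 'I_N}) :=
  Pointed.on (prodS X S).

Definition cylinders {N : nat} (X : 'I_N -> ptopologicalType) (S : {set 'I_N})
  : set (set (prodS X S)) :=
  [set B | exists (k : sidx S) (A : set (X (sval k))),
      <<s @open (X (sval k)) >> A /\ B = (fun x : prodS X S => x k) @^-1` A].

(** prod_{k in S} X_k as a measurable space (product = Borel sigma-algebra,
    since the X_k are Polish and S is finite). *)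
Definition PS {N : nat} (X : 'I_N -> ptopologicalType) (S : {set 'I_N}) :=
  g_sigma_algebraType (cylinders X S).

Definition prj {N : nat} {X : 'I_N -> Type} {S T : {set 'I_N}}
  (h : S \subset T) (x : prodS X T) : prodS X S :=
  fun k => x (exist _ (sval k) (fintype.subsetP h _ (svalP k))).

Lemma glue_aux {N : nat} {S T U : {set 'I_N}} (hU : U \subset S :|: T)
  (k : 'I_N) : k \in U -> k \notin S -> k \in T.
Proof. by move=> kU kS; have := fintype.subsetP hU k kU; rewrite inE (negbTE kS). Qed.

Definition glue {N : nat} {X : 'I_N -> Type} {S T U : {set 'I_N}}
  (hU : U \subset S :|: T) (x : prodS X S) (y : prodS X T) : prodS X U :=
  fun k =>
    (if sval k \in S as b return (sval k \in S) = b -> X (sval k)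
     then fun h => x (exist _ (sval k) h)
     else fun h => y (exist _ (sval k) (glue_aux hU (sval k) (svalP k) (negbT h))))
    (erefl _).

Lemma sub_setUC {N : nat} (A B : {set 'I_N}) : A :|: B \subset B :|: A.
Proof. by rewrite finset.setUC. Qed.

Lemma subT_setUCr {N : nat} (S : {set 'I_N}) : [set: 'I_N]%SET \subset S :|: ~: S.
Proof. by rewrite finset.setUCr. Qed.

Definition xcoord {N : nat} {X : 'I_N -> Type} (x : prodS X [set: 'I_N]%SET)
  (k : 'I_N) : X k := x (exist _ k (finset.in_setT k)).

Section MK.
Context {R : realType} {N : nat} {X : 'I_N -> completePseudoMetricType R}
  (mu : forall k : 'I_N, probability (borel (X k)) R).

Definition coupling {S : {set 'I_N}} (tau : probability (PS X S) R) :=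
  forall (k : sidx S) (A : set (borel (X (sval k)))), measurable A ->
    tau ((fun x : prodS X S => x k) @^-1` A) = mu (sval k) A.

Definition meq {d} {T : measurableType d} (m1 m2 : set T -> \bar R) :=
  forall A : set T, measurable A -> m1 A = m2 A.

Variables (c : prodS X [set: 'I_N]%SET -> R) (phi : forall k : 'I_N, X k -> R).

Definition optimal_MKP (lam : probability (PS X [set: 'I_N]%SET) R) :=
  coupling lam /\
  forall lam' : probability (PS X [set: 'I_N]%SET) R, coupling lam' ->
    (\int[lam]_x (c x)%:E <= \int[lam']_x (c x)%:E)%E.

Definition cS (S : {set 'I_N}) (y : prodS X S) : \bar R :=
  ereal_inf [set ((c (glue (subT_setUCr S) y z))%:E -
                  (\sum_(k in ~: S) phi k (xcoord (glue (subT_setUCr S) y z) k))%:E)%E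
            | z in [set: prodS X (~: S)]].

Definition optimal_RMKP {S : {set 'I_N}} (tau : probability (PS X S) R) :=
  coupling tau /\
  forall tau' : probability (PS X S) R, coupling tau' ->
    (\int[tau]_y cS S y <= \int[tau']_y cS S y)%E.

Definition unique_RMKP (S : {set 'I_N}) :=
  exists tau : probability (PS X S) R, optimal_RMKP tau /\
    forall tau', optimal_RMKP tau' -> meq tau tau'.

End MK.

Definition pprj {N : nat} {X : 'I_N -> ptopologicalType} {S T : {set 'I_N}}
  (h : S \subset T) : PS X T -> PS X S := prj h.

Definition pglue {N : nat} {X : 'I_N -> ptopologicalType} {S T U : {set 'I_N}}
  (hU : U \subset S :|: T) (x : PS X S) (y : PS X T) : PS X U := glue hU x y.

(* Main.v *)
Require Import Defs.
From HB Require Import structures.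
From mathcomp Require Import all_boot all_order all_algebra.
From mathcomp Require Import all_classical all_reals all_analysis.
From mathcomp Require Import measurable_realfun lra.
Import Order.TTheory GRing.Theory Num.Theory.
Local Open Scope classical_set_scope.
Local Open Scope ring_scope.

(** Write the slack as c - sum_k phi_k >= 0.

    Duality: a coupling with almost surely zero slack exists.  Since phi solves
    the dual problem, sum_k psi_k + t * slack >= 0 with t >= 0 forces
    sum_k int psi_k dmu_k >= 0, hence the functional sending h to the infimum
    of sum_k int psi_k dmu_k over all h <= sum_k psi_k + t * slack is sublinear
    on bounded functions and vanishes at 0.  A Hahn-Banach minorant yields a
    finitely additive plan with marginals mu_k that vanishes on every set
    [slack >= e].  Tightness of the mu_k makes it countably additive on the
    algebra of regular sets, and its Caratheodory extension is the coupling: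
    c being lower semicontinuous, [slack > 0] is a countable union of regular
    sets of measure zero.  So a coupling is optimal iff its slack vanishes
    almost surely.

    Reduced problems: c_S >= sum_{k in S} phi_k, with equality on the projection
    of [slack = 0], so the projection of an optimal plan to any S is optimal for
    the reduced problem.  The graph hypothesis then gives z_{Q_j} = T_j(z_P)
    almost surely for every j, and the plan is determined by its projection to
    Q u P, because rectangles form a pi-system generating the sigma-algebra. *)

(** * Hahn-Banach and finitely additive measures dominated by a cone *)

Section hahn_banach.
Context {R : realType} {V : lmodType R} (B : set V) (p : V -> R).
Hypothesis B0 : B 0.
Hypothesis BL : forall a x y, B x -> B y -> B (a *: x + y).
Hypothesis pD : forall x y, B x -> B y -> p (x + y) <= p x + p y.
Hypothesis pZ : forall a x, 0 < a -> B x -> p (a *: x) = a * p x.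

(** Partial linear functionals are encoded as linear relations, so that Zorn's lemma applies to
    inclusion; domination by [p] makes such a relation single-valued. *)
Let dominated_graph (G : set (V * R)) :=
  (forall a x r y s, G (x, r) -> G (y, s) -> G (a *: x + y, a * r + s)) /\
  (forall x r, G (x, r) -> B x /\ r <= p x).

Let BZ a x : B x -> B (a *: x).
Proof. by move=> Bx; have := BL a x 0 Bx B0; rewrite addr0. Qed.

Let BN x : B x -> B (- x).
Proof. by move=> Bx; rewrite -scaleN1r; exact: BZ. Qed.

Let BD x y : B x -> B y -> B (x + y).
Proof. by move=> Bx By; have := BL 1 x y Bx By; rewrite scale1r. Qed.

Let p0 : p 0 = 0.
Proof.
have h : (0 : R) < 2 by [].
by have := pZ 2 0 h B0; rewrite scaler0 => e; lra.
Qed.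

Let extend (G : set (V * R)) x0 : dominated_graph G -> B x0 -> G !=set0 ->
  (forall r, ~ G (x0, r)) -> exists G', G `<` G' /\ dominated_graph G'.
Proof.
move=> [GL Gp] Bx0 [[y0 s0] Gy0] Gx0.
have G0 : G (0, 0).
  by have := GL (-1) _ _ _ _ Gy0 Gy0; rewrite scaleN1r mulN1r !addNr.
have GZ a x r : G (x, r) -> G (a *: x, a * r).
  by move=> Gx; have := GL a _ _ _ _ Gx G0; rewrite !addr0.
(* The value at [x0] has to lie above every [r - p (y - x0)] and below every [p (z + x0) - s].
   Subadditivity makes the two families compatible, and the supremum of the first is taken. *)
pose S : set R := [set u.2 - p (u.1 - x0) | u in G].
have Sub z s : G (z, s) -> ubound S (p (z + x0) - s).
  move=> Gz _ [[y r] Gy] /= <-.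
  have Gyz := GL 1 _ _ _ _ Gy Gz; rewrite scale1r mul1r in Gyz.
  have [By _] := Gp _ _ Gy; have [Bz _] := Gp _ _ Gz.
  have := pD (y - x0) (z + x0) (BD _ _ By (BN _ Bx0)) (BD _ _ Bz Bx0).
  rewrite addrACA addNr addr0; have [_] := Gp _ _ Gyz; lra.
have S0 : S !=set0 by exists (s0 - p (y0 - x0)), (y0, s0).
have hsS : has_ubound S by exists (p (y0 + x0) - s0); exact: Sub.
pose a := sup S.
have aub z s : G (z, s) -> a + s <= p (z + x0).
  by move=> Gz; rewrite -lerBrDr; apply: ge_sup => //; exact: Sub.
have alb y r : G (y, r) -> r - a <= p (y - x0).
  move=> Gy; have : r - p (y - x0) <= a.
    by apply: ub_le_sup => //; exists (y, r).
  lra.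
exists [set u | exists y r t, G (y, r) /\ u = (y + t *: x0, r + t * a)].
split.
  split.
    by move=> [y r] Gy; exists y, r, 0; rewrite scale0r mul0r !addr0.
  move=> /(_ (x0, a)) GG; apply: (Gx0 a); apply: GG.
  by exists 0, 0, 1; rewrite scale1r mul1r !add0r.
split.
  move=> b x r y s [x1 [r1 [t1 [Gx [-> ->]]]]] [x2 [r2 [t2 [Gy [-> ->]]]]].
  exists (b *: x1 + x2), (b * r1 + r2), (b * t1 + t2); split; first exact: GL.
  congr pair; last lra.
  by rewrite scalerDr scalerDl scalerA addrACA.
move=> x r [y [s [t [Gy [-> ->]]]]]; have [By sp] := Gp _ _ Gy; split.
  by apply: BD => //; exact: BZ.
(* Positive homogeneity rescales to [t = -1] or [t = 1], where [alb] or [aub] applies. *)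
case: (ltgtP t 0) => [t0|t0|->]; last by rewrite scale0r mul0r !addr0.
- have u0 : 0 < - t by lra.
  have := alb _ _ (GZ (- t)^-1 _ _ Gy).
  rewrite -(ler_pM2l u0) -pZ//; last by apply: BD; [exact: BZ | exact: BN].
  rewrite scalerBr scalerA mulfV ?gt_eqF// scale1r scaleNr opprK.
  by rewrite mulrBr mulrA mulfV ?gt_eqF// mul1r; lra.
- have := aub _ _ (GZ t^-1 _ _ Gy).
  rewrite -(ler_pM2l t0) -pZ//; last by apply: BD => //; exact: BZ.
  rewrite scalerDr scalerA mulfV ?gt_eqF// scale1r.
  by rewrite mulrDr mulrA mulfV ?gt_eqF// mul1r; lra.
Qed.

(** A maximal dominated graph has all of [B] as its domain, since otherwise [extend] would enlarge
    it. *)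
Lemma hahn_banach : exists f : V -> R,
  (forall a x y, B x -> B y -> f (a *: x + y) = a * f x + f y) /\
  (forall x, B x -> f x <= p x).
Proof.
have [|G [Gdom Gmax]] := @Zorn_bigcup (V * R)%type dominated_graph.
  move=> F FP Ftot; split.
    move=> a x r y s [G1 FG1 G1x] [G2 FG2 G2y].
    have [G12|G21] := Ftot _ _ FG1 FG2.
      by exists G2 => //; apply: (FP _ FG2).1 => //; exact: G12.
    by exists G1 => //; apply: (FP _ FG1).1 => //; exact: G21.
  by move=> x r [G1 FG1 G1x]; exact: (FP _ FG1).2.
(* The empty relation is dominated too, so nonemptiness has to come from maximality. *)
have Gn0 : G !=set0.
  apply/set0P/eqP => G0; apply: (Gmax [set (0, 0)]).
    by rewrite G0; split=> [//|/(_ (0, 0))]; apply.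
  split; first by move=> a x r y s [-> ->] [-> ->] /=; rewrite scaler0 mulr0 !addr0.
  by move=> x r [-> ->]; rewrite p0.
have Gtot x : B x -> exists r, G (x, r).
  move=> Bx; apply: contrapT => /forallNP Gx.
  by have [G' [GG' G'd]] := extend G x Gdom Bx Gn0 Gx; exact: (Gmax G').
(* Linearity also puts [(0, - r)] in [G], and both values are at most [p 0 = 0]. *)
have G0r r : G (0, r) -> r = 0.
  move=> Gr; have GN := Gdom.1 (- 2) _ _ _ _ Gr Gr.
  rewrite scaler0 addr0 in GN.
  by have := (Gdom.2 _ _ Gr).2; have := (Gdom.2 _ _ GN).2; rewrite p0; lra.
have Gfun x r s : G (x, r) -> G (x, s) -> r = s.
  move=> Gr Gs; have := Gdom.1 (-1) _ _ _ _ Gr Gs.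
  by rewrite scaleN1r addNr => /G0r; lra.
have /choice[f fP] : forall x, exists r, B x -> G (x, r).
  move=> x; have [/Gtot[r Gr]|nBx] := pselect (B x); first by exists r.
  by exists 0.
exists f; split => [a x y Bx By|x Bx].
  by apply: Gfun (fP _ (BL a _ _ Bx By)) (Gdom.1 _ _ _ _ _ (fP _ Bx) (fP _ By)).
exact: (Gdom.2 _ _ (fP _ Bx)).2.
Qed.

End hahn_banach.

(** * Finitely additive probabilities below a cone of priced functions *)

Section cone_content.
Context {R : realType} {T : Type} (C : set ((T -> R) * R)).
Hypothesis CD : forall v a w b, C (v, a) -> C (w, b) ->
  C (fun x => v x + w x, a + b).
Hypothesis CZ : forall t v a, 0 < t -> C (v, a) -> C (fun x => t * v x, t * a).
Hypothesis Ccst : forall a, C (fun=> a, a).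
Hypothesis C_ge0 : forall v a, (forall x, 0 <= v x) -> C (v, a) -> 0 <= a.

Let bnd : set (T -> R^o) := [set h | exists M : R, forall x, `|h x| <= M].

Let maj (h : T -> R^o) : set R :=
  [set a | exists2 w, C (w, a) & forall x, h x <= w x].

(** The superhedging price of [h]. For bounded [h], the constants of the cone provide a majorant,
    and [C_ge0] bounds the prices from below. *)
Let p (h : T -> R^o) : R := inf (maj h).

Let maj_n0 h : bnd h -> maj h !=set0.
Proof.
move=> [M hM]; exists M, (fun=> M) => // x.
by rewrite (le_trans (ler_norm _)).
Qed.

Let maj_lb h : bnd h -> has_lbound (maj h).
Proof.
move=> [M hM]; exists (- M) => a [w Ca hw].
suff : 0 <= a + M by lra.
apply: C_ge0 (CD _ _ _ _ Ca (Ccst M)) => x.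
by have := hM x; rewrite ler_norml => /andP[+ _]; have := hw x; lra.
Qed.

Let p_le h w a : bnd h -> C (w, a) -> (forall x, h x <= w x) -> p h <= a.
Proof.
by move=> /maj_lb hlb Cw hw; apply: ge_inf => //; exists w.
Qed.

Let bnd0 : bnd (0 : T -> R^o).
Proof. by exists 0 => x; rewrite /= normr0. Qed.

Let bndL a h g : bnd h -> bnd g -> bnd (a *: h + g).
Proof.
move=> [M hM] [M' gM']; exists (`|a| * M + M') => x.
rewrite (le_trans (ler_normD _ _))// lerD// normrM.
exact: ler_wpM2l.
Qed.

Let bndZ a h : bnd h -> bnd (a *: h).
Proof. by move=> bh; rewrite -[a *: h]addr0; exact: bndL. Qed.

Let pD h g : bnd h -> bnd g -> p (h + g) <= p h + p g.
Proof.
move=> bh bg.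
have bhg : bnd (h + g) by rewrite -[h]scale1r; exact: bndL.
rewrite -lerBlDr; apply: lb_le_inf; first exact: maj_n0.
move=> a [v Cv hv]; rewrite lerBlDr -lerBlDl.
apply: lb_le_inf; first exact: maj_n0.
move=> b [w Cw hw]; rewrite lerBlDl.
apply: p_le (CD _ _ _ _ Cv Cw) _ => // x.
exact: lerD (hv x) (hw x).
Qed.

Let pZ_le t h : 0 < t -> bnd h -> t * p h <= p (t *: h).
Proof.
move=> t0 bh; apply: lb_le_inf; first by apply: maj_n0; exact: bndZ.
move=> a [w Cw hw]; rewrite mulrC -ler_pdivlMr//.
have ti : 0 < t^-1 by rewrite invr_gt0.
rewrite mulrC; apply: p_le (CZ _ _ _ ti Cw) _ => // x.
by rewrite mulrC ler_pdivlMr// mulrC; exact: hw.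
Qed.

Let pZ t h : 0 < t -> bnd h -> p (t *: h) = t * p h.
Proof.
move=> t0 bh; apply/eqP; rewrite eq_le pZ_le// andbT.
have ti : 0 < t^-1 by rewrite invr_gt0.
have := pZ_le t^-1 (t *: h) ti (bndZ t h bh).
by rewrite scalerA mulVf ?gt_eqF// scale1r mulrC ler_pdivrMr// mulrC.
Qed.

(** The content is a linear functional below [p], evaluated at indicators. Pricing [- \1_A] by 0
    gives positivity, pricing the constants 1 and -1 gives the total mass, and the last clause is
    domination by [p]. *)
Lemma cone_content : exists nu : set T -> R,
  [/\ forall A, 0 <= nu A, nu setT = 1,
      forall A B, A `&` B = set0 -> nu (A `|` B) = nu A + nu B &
      forall A w a, C (w, a) -> (forall x, \1_A x <= w x) -> nu A <= a].
Proof.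
have [l [lL lp]] := hahn_banach bnd p bnd0 bndL pD pZ.
have lle h w a : bnd h -> C (w, a) -> (forall x, h x <= w x) -> l h <= a.
  by move=> bh Cw hw; rewrite (le_trans (lp _ bh))//; exact: p_le Cw hw.
have bI A : bnd (\1_A : T -> R^o).
  by exists 1 => x; rewrite indicE; case: (_ \in _); rewrite ?normr1 ?normr0.
have l0 : l 0 = 0.
  have := lL 1 0 0 bnd0 bnd0; rewrite scale1r mul1r addr0; lra.
have lN h : bnd h -> l (- h) = - l h.
  by move=> bh; have := lL (-1) h 0 bh bnd0; rewrite scaleN1r !addr0 l0 addr0 mulN1r.
have bN h : bnd h -> bnd (- h) by rewrite -scaleN1r; exact: bndZ.
exists (fun A => l \1_A); split=> [A||A B AB0|A w a Cw Aw].
- rewrite -oppr_le0 -lN//; apply: lle (Ccst 0) _ => [|x]; first exact: bN.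
  by rewrite /= fctE oppr_le0 indicE ler0n.
- apply/eqP; rewrite eq_le; apply/andP; split.
    by apply: lle (Ccst 1) _ => // x; rewrite indicT.
  rewrite -lerN2 -lN//; apply: lle (Ccst (-1)) _ => [|x]; first exact: bN.
  by rewrite fctE indicT.
- rewrite -[l \1_A]mul1r -lL// scale1r; congr l.
  apply/funext => x; rewrite fctE !indicE in_setU.
  case: (boolP (x \in A)) => xA; case: (boolP (x \in B)) => xB /=;
    rewrite ?addr0 ?add0r//.
  by have [] : set0 x by rewrite -AB0; split; exact/set_mem.
- exact: lle Cw Aw.
Qed.

End cone_content.

(** * From tight finitely additive to countably additive *)

(** Defined on every subset, as the Hahn-Banach functional is; tightness is what yields countable
    additivity on regular sets. *)
Record tight_content (R : realType) (T : topologicalType) := TightContent {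
  tc :> set T -> R;
  tc_ge0 : forall A, 0 <= tc A;
  tcU : forall A B, A `&` B = set0 -> tc (A `|` B) = tc A + tc B;
  tc_tight : forall e, 0 < e -> exists2 K, compact K & tc (~` K) <= e }.

Arguments tc_ge0 {R T}.
Arguments tcU {R T}.
Arguments tc_tight {R T}.

(** Stated for a bare set function, to serve both for contents and for the real values of a
    probability. *)
Definition regular_for {R : realType} {T : topologicalType} (nu : set T -> R)
  : set (set T) :=
  [set A | forall e, 0 < e -> exists C U,
    [/\ closed C, open U, C `<=` A, A `<=` U & nu (U `\` C) <= e]].

Section tight_content_lemmas.
Context {R : realType} {T : ptopologicalType} (nu : tight_content R T).

Lemma tc0 : nu set0 = 0.
Proof. have := tcU nu set0 set0 (setI0 _); rewrite setU0; lra. Qed.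

Lemma tcDI A B : nu A = nu (A `\` B) + nu (A `&` B).
Proof. 
have AE : A = (A `\` B) `|` (A `&` B) by rewrite setUC setUIDK.
by rewrite {1}AE tcU// setDE setIACA setICl setI0.
Qed.

Lemma le_tc A B : A `<=` B -> nu A <= nu B.
Proof.
by move=> AB; rewrite (tcDI B A) (setIidr AB) lerDr tc_ge0.
Qed.

Lemma tcU_le A B : nu (A `|` B) <= nu A + nu B.
Proof.
rewrite (tcDI (A `|` B) A) (setIidr (@subsetUl _ A B)) addrC lerD2l.
by apply: le_tc => x [[]].
Qed.

Lemma tc_bigU_le (F : (set T)^nat) n :
  nu (\big[setU/set0]_(i < n) F i) <= \sum_(i < n) nu (F i).
Proof.
elim: n => [|n ih]; first by rewrite !big_ord0 tc0.
by rewrite !big_ord_recr /= (le_trans (tcU_le _ _))// lerD2r.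
Qed.

Lemma regular_forT : regular_for nu setT.
Proof.
move=> e e0; exists setT, setT; split => //; first exact: openT.
by rewrite setDT tc0 ltW.
Qed.

Lemma regular_forC A : regular_for nu A -> regular_for nu (~` A).
Proof.
move=> rA e /rA[C [U [cC oU CA AU CU]]]; exists (~` U), (~` C); split.
- exact: open_closedC.
- exact: closed_openC.
- exact: subsetC.
- exact: subsetC.
- by rewrite setDE setCK setIC -setDE.
Qed.

Lemma regular_forI A B :
  regular_for nu A -> regular_for nu B -> regular_for nu (A `&` B).
Proof.
move=> rA rB e e0; have e20 : 0 < e / 2 by rewrite divr_gt0.
have [C [U [cC oU CA AU CU]]] := rA _ e20.
have [D [V [cD oV DB BV DV]]] := rB _ e20.
exists (C `&` D), (U `&` V); split.
- exact: closedI.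
- exact: openI.
- exact: setISS.
- exact: setISS.
- have UVCD : (U `&` V) `\` (C `&` D) `<=` (U `\` C) `|` (V `\` D).
    move=> x [[Ux Vx] /not_andP[nC|nD]]; [by left|by right].
  rewrite (le_trans (le_tc _ _ UVCD))// (le_trans (tcU_le _ _))//.
  by rewrite (splitr e) lerD.
Qed.

Lemma regular_forD : setD_closed (regular_for nu).
Proof.
move=> A B rA rB; rewrite setDE; apply: regular_forI => //.
exact: regular_forC.
Qed.

(* Open covers reduce to finite ones by compactness; this is the only place
   where countable additivity is gained. *)
Lemma tc_sigma_subadditive A (F : (set T)^nat) :
  regular_for nu A -> (forall n, regular_for nu (F n)) ->
  A `<=` \bigcup_n F n ->
  ((nu A)%:E <= \sum_(n <oo) (nu (F n))%:E)%E.
Proof.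
move=> rA rF AF; apply/lee_addgt0Pr => e e0.
(* One third of [e] goes to the approximation of [A] by [C], one to the complement of [K], and one
   to the open enlargements of the [F n]. *)
have e30 : 0 < e / 3 by rewrite divr_gt0.
have [C [U0 [cC _ CA AU CU]]] := rA _ e30.
have [K cK nK] := tc_tight nu _ e30.
have e30' n : 0 < e / 3 / 2 ^+ n.+1 by rewrite divr_gt0// exprn_gt0.
have /choice[U hU] : forall n, exists U,
    [/\ open U, F n `<=` U & nu U <= nu (F n) + e / 3 / 2 ^+ n.+1].
  move=> n; have [D [U [cD oU DF FU DU]]] := rF n _ (e30' n).
  exists U; split => //; rewrite (tcDI U (F n)) (setIidr FU) addrC lerD2l.
  by apply: le_trans DU; apply: le_tc => x [Ux nF]; split => // /DF.
have : compact (K `&` C) by exact: compact_closedI.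
rewrite compact_cover.
move=> /(_ nat setT U (fun i _ => let: And3 oU _ _ := hU i in oU)) [].
  by move=> x [_ /CA/AF[n _ Fnx]]; exists n => //; case: (hU n) => _ + _; apply.
move=> D _ DU.
pose m := (\max_(i <- finmap.enum_fset D) i).+1.
have KCU : K `&` C `<=` \big[setU/set0]_(i < m) U i.
  move=> x /DU[n Dn Unx]; rewrite -bigcup_mkord; exists n => //=.
  by rewrite ltnS; exact: (@leq_bigmax_seq _ _ xpredT id).
have hA : nu A <= \sum_(i < m) nu (U i) + e / 3 + e / 3.
  (* A point of [A] lies in the finite subcover, outside [K], or outside [C]. *)
  have AS : A `<=` (\big[setU/set0]_(i < m) U i `|` ~` K) `|` (A `\` C).
    move=> x Ax; have [Cx|nCx] := pselect (C x); last by right.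
    left; have [Kx|nKx] := pselect (K x); last by right.
    by left; exact: KCU.
  apply: (le_trans (le_tc _ _ AS)); apply: (le_trans (tcU_le _ _)).
  apply: lerD.
    apply: (le_trans (tcU_le _ _)); apply: lerD => //.
    exact: tc_bigU_le.
  by apply: le_trans CU; apply: le_tc => x [/AU Ux nC].
have hS : ((\sum_(i < m) nu (U i))%:E <=
    \sum_(n <oo) (nu (F n))%:E + (e / 3)%:E)%E.
  rewrite (le_trans _ (epsilon_trick _ _ _))//; last 2 first.
  - by move=> n; rewrite lee_fin tc_ge0.
  - exact: ltW.
  rewrite -sumEFin.
  apply: (@le_trans _ _ (\sum_(i < m)
     ((nu (F i))%:E + (e / 3 / (2 ^ i.+1)%:R)%:E)))%E.
    apply: lee_sum => i _; rewrite -EFinD lee_fin natrX.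
    by case: (hU i).
  rewrite -(big_mkord xpredT
    (fun i => (nu (F i))%:E + (e / 3 / (2 ^ i.+1)%:R)%:E)%E).
  apply: nneseries_lim_ge => n _ _.
  rewrite -EFinD lee_fin addr_ge0 ?tc_ge0// natrX.
  exact: ltW.
apply: (@le_trans _ _ ((\sum_(i < m) nu (U i))%:E + (e / 3 + e / 3)%:E))%E.
  by rewrite -EFinD lee_fin addrA.
apply: (le_trans (leeD2r _ hS)).
by rewrite -addeA -EFinD leeD2l// lee_fin; lra.
Qed.

End tight_content_lemmas.

(* Carrier alias on which the regular sets form an algebra of sets. *)
Definition regular_algebra {R : realType} {T : topologicalType}
  (nu : tight_content R T) : Type := T.

Section regular_algebra.
Context {R : realType} {T : ptopologicalType} (nu : tight_content R T).
Local Notation A := (regular_algebra nu).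

HB.instance Definition _ := Pointed.on A.
HB.instance Definition _ := isAlgebraOfSets_setD.Build default_measure_display A
  (regular_forT nu) (regular_forD nu).

Definition regular_measure (B : set A) : \bar R := (nu B)%:E.

Let regular_measure_ge0 B : (0 <= regular_measure B)%E.
Proof. by rewrite lee_fin tc_ge0. Qed.

Let regular_measure_semi_additive : measure_function.semi_additive regular_measure.
Proof.
move=> F n mF tF mUF; rewrite /regular_measure sumEFin; congr EFin.
elim: n {mUF} => [|n ih]; first by rewrite !big_ord0 tc0.
rewrite !big_ord_recr/= tcU ?ih// big_distrl/= big1// => i _.
have /trivIsetP/(_ i n I I) := tF; apply.
by rewrite neq_ltn ltn_ord.
Qed.

HB.instance Definition _ := isContent.Build _ A R regular_measure
  regular_measure_ge0 regular_measure_semi_additive.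

Let regular_measure_sigma_subadditive :
  measurable_subset_sigma_subadditive regular_measure.
Proof. by move=> B F mF mB; exact: tc_sigma_subadditive. Qed.

HB.instance Definition _ := Content_SigmaSubAdditive_isMeasure.Build _ R A
  regular_measure regular_measure_sigma_subadditive.

(** Caratheodory extension of the content on regular sets. It is given as a bare set function so
    that it can later be restricted to the sigma-algebra of the cylinders. *)
Lemma tight_content_extension : exists P : set T -> \bar R,
  [/\ P set0 = 0, forall B, (0 <= P B)%E,
      forall F : (set T)^nat, (forall n, <<s regular_for nu >> (F n)) ->
        trivIset setT F ->
        (\sum_(0 <= i < n) P (F i))%E @[n --> \oo] --> P (\bigcup_n F n) &
      forall B, regular_for nu B -> P B = (nu B)%:E].
Proof.
exists (measure_extension regular_measure); split.
- exact: measure0.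
- by move=> B; exact: measure_ge0.
- move=> F mF tF; apply: measure_semi_sigma_additive => //.
  exact: (@bigcupT_measurable _ (g_sigma_algebraType (@measurable _ A))).
- by move=> B rB; exact: measurable_mu_extE.
Qed.

End regular_algebra.

(** * Borel probability measures on Polish spaces *)

Section probability_approx.
Context {R : realType} {d} {T : measurableType d} (P : probability T R).

(** The tails decrease to the empty set, so continuity from above applies. *)
Lemma probability_bigcup_tail (F : (set T)^nat) (e : R) : 0 < e ->
  (forall n, measurable (F n)) ->
  exists m, (P (\bigcup_n F n `\` \big[setU/set0]_(i < m) F i) <= e%:E)%E.
Proof.
move=> e0 mF; pose E m := \bigcup_n F n `\` \big[setU/set0]_(i < m) F i.
have mE m : measurable (E m).
  by apply: measurableD; [exact: bigcupT_measurable|exact: bigsetU_measurable].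
have E0 : \bigcap_n E n = set0.
  apply/seteqP; split => // x Ex.
  have [[n _ Fnx] _] := Ex 0%N I; have [_] := Ex n.+1 I; apply.
  by rewrite -bigcup_mkord; exists n => //=.
have Poo : (P (E 0%N) < +oo)%E by rewrite ltey_eq fin_num_measure.
have : (P \o E) x @[x --> \oo] --> P (\bigcap_n E n).
  apply: nonincreasing_cvg_mu => //.
    by apply: bigcap_measurable => //; exists 0%N.
  move=> n m nm; apply/subsetPset => x [Fx nE]; split => // UE; apply: nE.
  exact: subset_bigsetU UE.
rewrite E0 measure0 => /fine_cvgP[_] /cvgrPdist_le /(_ _ e0)[m _ /(_ m (leqnn m))].
rewrite /= sub0r normrN ger0_norm ?fine_ge0// => PE.
by exists m; rewrite -(fineK (fin_num_measure P _ (mE m))) lee_fin.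
Qed.

Lemma probability_le_geometric (A : set T) (F : (set T)^nat) (e : R) : 0 < e ->
  measurable A -> (forall n, measurable (F n)) -> A `<=` \bigcup_n F n ->
  (forall n, (P (F n) <= (e / 2 ^+ n.+1)%:E)%E) -> (P A <= e%:E)%E.
Proof.
move=> e0 mA mF AF PF.
rewrite (le_trans (measure_sigma_subadditive P mF mA AF))//.
apply: le_trans (epsilon_trick0 xpredT (ltW e0)).
by apply: lee_nneseries => [n _ _|n _]; rewrite ?measure_ge0// natrX; exact: PF.
Qed.

End probability_approx.

Section regular_probability.
Context {R : realType} {T : ptopologicalType} (G : set (set T)).
Variable P : probability (g_sigma_algebraType G) R.
Hypothesis openG : @open T `<=` <<s G >>.

Lemma closed_sigma (A : set T) : closed A -> <<s G >> A.
Proof.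
by move=> /closed_openC/openG/(@sigma_algebraC T G); rewrite setCK.
Qed.

Let reg : set (set T) := regular_for (fun A => fine (P A)).

(** Good-sets argument: complementation exchanges closed and open approximants. For a countable
    union the open ones are united, while finitely many closed ones suffice up to a tail of small
    measure. *)
Lemma sigma_regular : G `<=` reg -> <<s G >> `<=` reg.
Proof.
move=> Greg; suff : <<s G >> `<=` [set A | <<s G >> A /\ reg A].
  by move=> h A /h[].
apply: smallest_sub; last first.
  by move=> A GA; split; [exact: sub_sigma_algebra|exact: Greg].
split.
- split; first exact: (@measurable0 _ (g_sigma_algebraType G)).
  move=> e e0; exists set0, set0; split; [exact: closed0|exact: open0|by []|by []|].
  by rewrite setD0 measure0 ltW.
- move=> A [mA rA]; rewrite setTD; split; first exact: sigma_algebraC.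
  move=> e /rA[C [U [cC oU CA AU CU]]]; exists (~` U), (~` C); split.
  + exact: open_closedC.
  + exact: closed_openC.
  + exact: subsetC.
  + exact: subsetC.
  + by rewrite setDE setCK setIC -setDE.
move=> F Freg; have mF n : <<s G >> (F n) := (Freg n).1.
split; first exact: (@bigcupT_measurable _ (g_sigma_algebraType G)).
move=> e e0; have e20 : 0 < e / 2 by rewrite divr_gt0.
have e2n n : 0 < e / 2 / 2 ^+ n.+1 by rewrite divr_gt0// exprn_gt0.
have /choice[CU hCU] : forall n, exists CU : set T * set T,
    [/\ closed CU.1, open CU.2, CU.1 `<=` F n, F n `<=` CU.2 &
     fine (P (CU.2 `\` CU.1)) <= e / 2 / 2 ^+ n.+1].
  by move=> n; have [C [U]] := (Freg n).2 _ (e2n n); exists (C, U).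
pose C n : set (g_sigma_algebraType G) := (CU n).1.
pose U n : set (g_sigma_algebraType G) := (CU n).2.
have mC n : measurable (C n) by apply: closed_sigma; case: (hCU n).
have mU n : measurable (U n) by apply: openG; case: (hCU n).
have [m Pm] := probability_bigcup_tail P C _ e20 mC.
exists (\big[setU/set0]_(i < m) C i), (\bigcup_n U n); split.
- by apply: closed_bigsetU => i _; case: (hCU i).
- by apply: bigcup_open => n _; case: (hCU n).
- rewrite -bigcup_mkord => x [n _ Cx]; exists n => //.
  by case: (hCU n) => _ _ + _ _; apply.
- by apply: subset_bigcup => n _; case: (hCU n).
have mbC : measurable (\big[setU/set0]_(i < m) C i).
  exact: bigsetU_measurable.
have mbU : measurable (\bigcup_n U n) by exact: bigcupT_measurable.
have mbCn : measurable (\bigcup_n C n) by exact: bigcupT_measurable.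
have P1 : (P (\bigcup_n U n `\` \bigcup_n C n) <= (e / 2)%:E)%E.
  apply: (@probability_le_geometric _ _ _ _ _ (fun n => U n `\` C n)) => //.
  - exact: measurableD.
  - by move=> n; exact: measurableD.
  - by move=> x [[n _ Ux] nC]; exists n => //; split => // Cx; apply: nC; exists n.
  - move=> n; rewrite -[P _]fineK ?fin_num_measure//; last exact: measurableD.
    by rewrite lee_fin; case: (hCU n).
rewrite -lee_fin fineK; last by apply: fin_num_measure; exact: measurableD.
apply: (@le_trans _ _ (P ((\bigcup_n U n `\` \bigcup_n C n) `|`
    (\bigcup_n C n `\` \big[setU/set0]_(i < m) C i)))).
  apply: le_measure; rewrite ?inE.
  - exact: measurableD.
  - by apply: measurableU; exact: measurableD.
  - move=> x [Ux nC]; have [Cx|nCx] := pselect ((\bigcup_n C n) x).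
      by right.
    by left.
apply: (le_trans (measureU2 P _ _)); [exact: measurableD|exact: measurableD|].
by rewrite [leRHS](_ : _ = (e / 2)%:E + (e / 2)%:E)%E ?leeD// -EFinD -splitr.
Qed.

End regular_probability.

Section polish_probability.
Context {R : realType} {X : completePseudoMetricType R}.
Variable mu : probability (borel X) R.

(** Balls of a pseudometric structure need not be open, hence the interior. *)
Let B (x : X) n : set X := (ball x (n.+1%:R^-1))^°.

Let openB x n : open (B x n). Proof. exact: open_interior. Qed.

Let ball_sub (x y : X) n : ball x (n.+1%:R^-1 / 2) y -> B x n y.
Proof.
move=> xy; apply/nbhs_ballP; exists ((n.+1%:R^-1 : R) / 2).
  by rewrite /= divr_gt0// invr_gt0.
by move=> z yz; rewrite [_^-1]splitr; exact: ball_triangle xy yz.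
Qed.

(** An open [U] is the countable union of the closed sets of points that no [B y n] centred outside
    [U] contains; finitely many of them approximate [U] from inside. *)
Lemma borel_regular (A : set X) : <<s @open X >> A ->
  regular_for (fun A => fine (mu A)) A.
Proof.
move: A; apply: sigma_regular; first by move=> A; exact: sub_sigma_algebra.
move=> U oU e e0.
pose C n : set (borel X) := ~` \bigcup_(y in ~` U) B y n.
have cC n : closed (C n : set X).
  by apply: open_closedC; apply: bigcup_open.
have mC n : measurable (C n).
  by apply: closed_sigma => // ? ?; exact: sub_sigma_algebra.
have CU n : C n `<=` U.
  move=> x Cx; apply: contrapT => nUx; apply: Cx; exists x => //.
  apply: ball_sub; apply: ballxx; by rewrite divr_gt0// invr_gt0.
have UC : U `<=` \bigcup_n C n.
  move=> x Ux; have /nbhs_ballP[r /= r0 rU] : nbhs x U.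
    exact: open_nbhs_nbhs.
  have [n] := ltr_add_invr r0; rewrite add0r => /ltW nr.
  exists n => // -[y nUy /interior_subset /= yx]; apply: nUy; apply: rU.
  by apply: le_ball nr _ _; exact: ball_sym.
have [m Pm] := probability_bigcup_tail mu C _ e0 mC.
exists (\big[setU/set0]_(i < m) C i), U; split => //.
- by apply: closed_bigsetU.
- by rewrite -bigcup_mkord => x [n _ /CU].
have <- : \bigcup_n C n = U by apply/seteqP; split => // x [n _ /CU].
rewrite -lee_fin fineK//; apply: fin_num_measure.
by apply: measurableD; [exact: bigcupT_measurable|exact: bigsetU_measurable].
Qed.

Hypothesis sepX : separable_space X.

Lemma separable_dense_seq : exists s : X^nat,
  forall x r, 0 < r -> exists i, ball (s i) r x.
Proof.
have [D [cD clD]] := sepX.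
have D0 : D !=set0.
  have : closure D point by rewrite clD.
  by move=> /(_ setT filterT)[x []]; exists x.
have /pfcard_geP[D0'|[s]] := cD; first by move: D0; rewrite D0' => -[].
exists s => x r r0; have : closure D x by rewrite clD.
move=> /(_ (ball x r) (nbhsx_ballx _ _ r0))[y [Dy xy]].
have [i _ siy] := @surj _ _ _ _ s _ Dy.
by exists i; rewrite siy; exact: ball_sym.
Qed.

Lemma separable_countable_base : exists b : nat -> set X,
  (forall i, open (b i)) /\
  (forall U x, open U -> U x -> exists i, b i x /\ b i `<=` U).
Proof.
have [s sd] := separable_dense_seq.
(* Pairs of a centre and a radius are coded by natural numbers; numbers that code no pair stand for
   the empty set. *)
exists (fun i => if @unpickle (nat * nat)%type i is Some (j, n) then B (s j) n
   else set0); split=> [i|U x oU Ux].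
  by case: unpickle => [[j n]|]; [exact: openB|exact: open0].
have /nbhs_ballP[r /= r0 rU] : nbhs x U by exact: open_nbhs_nbhs.
have r20 : 0 < r / 2 by rewrite divr_gt0.
have [n] := ltr_add_invr r20; rewrite add0r => /ltW nr.
have [j sjx] : exists i, ball (s i) (n.+1%:R^-1 / 2) x.
  by apply: sd; rewrite divr_gt0// invr_gt0.
exists (pickle (j, n)); rewrite pickleK; split; first exact: ball_sub.
move=> y /interior_subset/= sjy; apply: rU; rewrite (splitr r).
apply: (@ball_triangle _ _ (s j)); last exact: le_ball nr _ sjy.
apply: ball_sym; apply: le_ball _ _ sjx.
by rewrite ler_wpM2r ?invr_ge0// (le_trans nr)// ler_pdivrMr// ler_peMr// ?ler1n// ltW.
Qed.

(** Ulam's theorem: at each scale [n], finitely many closures of small balls cover all but mass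
    [e / 2 ^+ n.+1]; the intersection over [n] is closed and totally bounded, hence compact by
    completeness. *)
Lemma polish_tight (e : R) : 0 < e ->
  exists2 K : set X, compact K /\ closed K & fine (mu (~` K)) <= e.
Proof.
move=> e0; have [s sd] := separable_dense_seq.
have e2n n : 0 < e / 2 ^+ n.+1 by rewrite divr_gt0// exprn_gt0.
have mB x n : measurable (B x n : set (borel X)).
  by apply: sub_sigma_algebra; exact: openB.
have Bcov n : \bigcup_i B (s i) n = setT.
  apply/seteqP; split => // x _.
  have [i six] : exists i, ball (s i) (n.+1%:R^-1 / 2) x.
    by apply: sd; rewrite divr_gt0// invr_gt0.
  by exists i => //; exact: ball_sub.
have /choice[m hm] : forall n, exists m,
    (mu (setT `\` \big[setU/set0]_(i < m) B (s i) n) <= (e / 2 ^+ n.+1)%:E)%E.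
  move=> n; rewrite -(Bcov n).
  by apply: (probability_bigcup_tail mu (fun i => B (s i) n)).
pose E n : set X := \big[setU/set0]_(i < m n) closure (B (s i) n).
have cE n : closed (E n) by apply: closed_bigsetU => i _; exact: closed_closure.
have mC (A : set X) : closed A -> measurable (A : set (borel X)).
  by apply: closed_sigma => ? ?; exact: sub_sigma_algebra.
have cK : closed (\bigcap_n E n) by apply: closed_bigI => n _; exact: cE.
exists (\bigcap_n E n); last first.
  rewrite -lee_fin fineK; last first.
    by apply: fin_num_measure; apply: measurableC; exact: mC.
  apply: (@probability_le_geometric _ _ _ mu _ (fun n => ~` E n)) => //.
  - by apply: measurableC; exact: mC.
  - by move=> n; apply: measurableC; exact: mC.
  - by rewrite setC_bigcap.
  - move=> n; apply: le_trans (hm n); apply: le_measure; rewrite ?inE.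
    + by apply: measurableC; exact: mC.
    + by apply: measurableD => //; exact: bigsetU_measurable.
    + move=> x nEx; split => // Ux; apply: nEx; move: Ux.
      rewrite -(@bigcup_mkord X (m n) (fun i => B (s i) n)).
      rewrite /E -(@bigcup_mkord X (m n) (fun i => closure (B (s i) n))).
      move=> -[i im Bx]; exists i => //.
      exact: subset_closure.
split=> //; rewrite compact_ultra => F FU FK.
(* At each scale the ultrafilter contains a finite union of closures of small balls, hence one of
   them. *)
have Fc : cauchy F.
  apply: cauchy_exP => r r0; have r20 : 0 < r / 2 by rewrite divr_gt0.
  have [n] := ltr_add_invr r20; rewrite add0r => /ltW nr.
  have : F (E n) by apply: filterS FK => x; exact.
  rewrite /E; elim: (m n) => [|k ih].
    by rewrite big_ord0 => /filter_ex[].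
  rewrite big_ord_recr/=.
  have [Fk _|Fk FU'] := in_ultra_setVsetC (closure (B (s k) n)) FU.
    exists (s k); apply: filterS Fk => x.
    have r20' : 0 < r / 2 by [].
    move=> /(_ _ (nbhsx_ballx x _ r20'))[y [/interior_subset/= sy xy]].
    rewrite (splitr r); apply: ball_triangle (ball_sym xy).
    exact: le_ball nr _ sy.
  by apply: ih; apply: filterS (filterI Fk FU') => x [nx []].
have /cvg_ex[p Fp] : cvg F by exact: cauchy_cvg.
exists p; split => //; apply: (closed_cvg _ cK) Fp.
exact: FK.
Qed.

End polish_probability.

(** * Finite products of Polish spaces *)

Section finite_product.
Context {I : finType} {K : I -> ptopologicalType}.
Local Notation T := (prod_topology (K : I -> Type)).

Definition box (A : forall i, set (K i)) : set T := [set x | forall i, A i (x i)].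

Lemma boxE A : box A = \big[setI/setT]_i ((fun x : T => x i) @^-1` (A i)).
Proof.
rewrite -bigcap_seq; apply/seteqP; split=> [x Ax i _|x xA i]; first exact: Ax.
by apply: xA => /=; exact: mem_index_enum.
Qed.

Let box_filter (x : T) : set_system T := [set V | exists A,
  [/\ forall i, open (A i), box A x & box A `<=` V]].

Let box_filter_filter x : Filter (box_filter x).
Proof.
split.
- by exists (fun=> setT); split => // i; exact: openT.
- move=> V W [A [oA Ax AV]] [B [oB Bx BW]].
  exists (fun i => A i `&` B i); split => [i|i|y yAB].
  + exact: openI.
  + by split; [exact: Ax|exact: Bx].
  + by split; [apply: AV => i|apply: BW => i]; case: (yAB i).
- by move=> V W VW [A [oA Ax AV]]; exists A; split => // y /AV/VW.
Qed.

(** The claim says that the filter of open boxes around [x] converges to [x], and convergence in the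
    product topology can be checked one coordinate at a time. *)
Lemma open_box_nbhs (U : set T) (x : T) : open U -> U x ->
  exists A, [/\ forall i, open (A i), box A x & box A `<=` U].
Proof.
move=> oU Ux; suff : box_filter x --> x by apply; exact: open_nbhs_nbhs.
apply/cvg_sup; first exact: box_filter_filter.
move=> i V.
rewrite nbhsE => -[W [[A oA <-] Ax] WV].
(* The box that constrains coordinate [i] only. *)
exists (dfwith (fun j => setT : set (K j)) i A); split=> [j|j|y yA].
- by case: dfwithP => // *; exact: openT.
- by case: dfwithP.
- by apply: WV => /=; have := yA i; rewrite dfwithin.
Qed.

Lemma open_coord i (A : set (K i)) : open A -> open [set x : T | A (x i)].
Proof.
by move=> oA; apply: open_comp => // x _; exact: (@proj_continuous I K i).
Qed.

Lemma closed_coord i (A : set (K i)) : closed A -> closed [set x : T | A (x i)].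
Proof.
by move=> cA; apply: closed_comp => // x _; exact: (@proj_continuous I K i).
Qed.

Lemma compact_box (A : forall i, set (K i)) :
  (forall i, compact (A i)) -> compact (box A).
Proof. exact: tychonoff. Qed.

Lemma open_countable_boxes :
  (forall i, exists b : nat -> set (K i), (forall n, open (b n)) /\
    (forall U x, open U -> U x -> exists n, b n x /\ b n `<=` U)) ->
  forall U : set T, open U -> exists (A : nat -> forall i, set (K i)) (D : set nat),
    (forall n i, open (A n i)) /\ U = \bigcup_(n in D) box (A n).
Proof.
move=> hb U oU.
pose b i := sval (cid (hb i)).
have ob i n : open (b i n) by rewrite /b; case: (cid _) => b' [].
have bP i V x : open V -> V x -> exists n, b i n x /\ b i n `<=` V.
  by rewrite /b; case: (cid _) => b' [_ b'P] /=; exact: b'P.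
pose A n i : set (K i) :=
  if @unpickle {ffun I -> nat} n is Some f then b i (f i) else set0.
exists A, [set n | box (A n) `<=` U]; split=> [n i|].
  by rewrite /A; case: unpickle => // ; exact: open0.
apply/seteqP; split=> [x Ux|x [n /= + Ax]]; last exact.
have [B [oB Bx BU]] := open_box_nbhs _ _ oU Ux.
pose f := [ffun i => sval (cid (bP i _ _ (oB i) (Bx i)))].
have fP i : b i (f i) (x i) /\ b i (f i) `<=` B i.
  by rewrite ffunE; case: (cid _).
have Af i : A (pickle f) i = b i (f i) by rewrite /A pickleK.
exists (pickle f) => [y Ay|i] /=; last by rewrite Af; exact: (fP i).1.
by apply: BU => i; apply: (fP i).2; have := Ay i; rewrite Af.
Qed.

End finite_product.

HB.instance Definition _ (I : Type) (K : I -> ptopologicalType) :=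
  Pointed.copy (prod_topology (K : I -> Type)) (forall i, K i).

Section product_measurable.
Context {R : realType} {N : nat} {X : 'I_N -> completePseudoMetricType R}.
Hypothesis sepX : forall k, separable_space (X k).

(* Same carrier as [PS X S], with the product topology. *)
Definition TS (S : {set 'I_N}) : ptopologicalType :=
  prod_topology (fun k : {k : 'I_N | k \in S} => X (sval k)).

Lemma measurable_coord (S : {set 'I_N}) (k : sidx S) (A : set (X (sval k))) :
  <<s @open (X (sval k)) >> A ->
  measurable ((fun x : PS X S => x k) @^-1` A).
Proof. by move=> mA; apply: sub_sigma_algebra; exists k, A. Qed.

(** Second countability of the factors puts the open sets of the product into the sigma-algebra
    generated by cylinders. *)
Lemma open_measurable_PS (S : {set 'I_N}) (U : set (TS S)) :
  open U -> <<s cylinders X S >> U.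
Proof.
move=> oU.
have [|A [D [oA ->]]] := @open_countable_boxes _
  (fun k : {k | k \in S} => X (sval k)) _ U oU.
  by move=> i; exact: separable_countable_base.
have mA n : measurable (box (A n) : set (PS X S)).
  rewrite boxE; apply: (@bigsetI_measurable _ (PS X S)) => k _.
  by apply: measurable_coord; apply: sub_sigma_algebra; exact: oA.
by apply: (@bigcup_measurable _ (PS X S)) => n _; exact: mA.
Qed.

End product_measurable.

Lemma measure_bigsetU_le {d} {T : measurableType d} {R : realType}
    (P : {measure set T -> \bar R}) (I : finType) (F : I -> set T) :
  (forall i, measurable (F i)) ->
  (P (\big[setU/set0]_i F i) <= \sum_i P (F i))%E.
Proof.
move=> mF; elim: (index_enum I) => [|i s ih]; first by rewrite !big_nil measure0.
rewrite !big_cons; apply: le_trans (leeD2l _ ih).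
by apply: measureU2 => //; exact: bigsetU_measurable.
Qed.

Section law.
Context {d d'} {T : measurableType d} {T' : measurableType d'} {R : realType}.
Variables (P : probability T R) (f : T -> T') (mf : measurable_fun setT f).

Let mf_mixin := isMeasurableFun.Build _ _ _ _ _ mf.
Let mf_pack : {mfun T >-> T'} := HB.pack f mf_mixin.

(** Bundling the measurability proof makes the image measure a probability rather than a mere set
    function. *)
Definition law : probability T' R := distribution P mf_pack.

Lemma lawE A : law A = P (f @^-1` A). Proof. by []. Qed.

End law.

(** * Regularity and inner compactness on finite products *)

Section product_regular.
Context {R : realType} {N : nat} {X : 'I_N -> completePseudoMetricType R}.
Hypothesis sepX : forall k, separable_space (X k).

Lemma measurable_fun_coord (S : {set 'I_N}) (k : sidx S) :
  measurable_fun setT ((fun x : PS X S => x k) : PS X S -> borel (X (sval k))).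
Proof. by move=> _ A mA; rewrite setTI; exact: measurable_coord. Qed.

(** Coordinate preimages keep closed sets closed and open sets open. As only a bound by [Q] on
    cylinders is asked, this serves the finitely additive plan as well as probabilities. *)
Lemma regular_coord (S : {set 'I_N}) (k : {k | k \in S})
    (Q : set (X (sval k)) -> R) (nu : set (TS (X := X) S) -> R) A :
  (forall A, <<s @open (X (sval k)) >> A ->
     nu ((fun x : TS S => x k) @^-1` A) <= Q A) ->
  <<s @open (X (sval k)) >> A ->
  regular_for Q A -> regular_for nu ((fun x : TS S => x k) @^-1` A).
Proof.
move=> nuQ mA rA e /rA[C [U [cC oU CA AU CU]]].
exists ((fun x => x k) @^-1` C), ((fun x => x k) @^-1` U); split.
- exact: (@closed_coord _ (fun k : {k | k \in S} => X (sval k)) k C).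
- exact: (@open_coord _ (fun k : {k | k \in S} => X (sval k)) k U).
- by move=> x /CA.
- by move=> x /AU.
- apply: le_trans CU; apply: nuQ.
  apply: (@measurableD _ (borel (X (sval k)))).
    exact: sub_sigma_algebra.
  by apply: closed_sigma => // ? ?; exact: sub_sigma_algebra.
Qed.

Variables (S : {set 'I_N}) (P : probability (PS X S) R).

Lemma PS_regular (A : set (PS X S)) : measurable A ->
  regular_for (fun B : set (TS S) => fine (P B)) A.
Proof.
move: A; apply: (@sigma_regular R (TS S) (cylinders X S) P).
  exact: open_measurable_PS.
move=> _ [k [A [mA ->]]].
apply: (regular_coord _ _ (fun B => fine (law P _ (measurable_fun_coord S k) B))) => //.
exact: borel_regular.
Qed.

(** A closed inner approximation is cut by a box of compacts that are tight for the marginals. The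
    box is compact by Tychonoff, and its complement is a finite union of cylinders of small mass. *)
Lemma PS_inner_compact (A : set (PS X S)) (e : R) : measurable A -> 0 < e ->
  exists K : set (TS S), [/\ compact K, <<s cylinders X S >> K, K `<=` A &
    fine (P (A `\` K)) <= e].
Proof.
move=> mA e0; have e20 : 0 < e / 2 by rewrite divr_gt0.
have [C [U [cC oU CA AU CU]]] := PS_regular A mA _ e20.
(* The successor keeps each share positive even when [S] is empty. *)
have ek0 : 0 < e / 2 / (#|{: {k | k \in S}}|.+1)%:R by rewrite divr_gt0.
have hK (k : sidx S) := polish_tight (law P _ (measurable_fun_coord S k)) (sepX _) _ ek0.
pose L k : set (X (sval k)) := s2val (cid2 (hK k)).
have LP k : compact (L k) /\ closed (L k).
  by rewrite /L; case: (cid2 _).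
have LE k : fine (law P _ (measurable_fun_coord S k) (~` L k)) <=
    e / 2 / (#|{: {k | k \in S}}|.+1)%:R.
  by rewrite /L; case: (cid2 _).
have cB : compact (box L : set (TS S)) by apply: compact_box => k; case: (LP k).
have mL k : measurable ((fun x : PS X S => x k) @^-1` (~` L k)).
  apply: measurable_coord; apply: sigma_algebraC.
  by apply: closed_sigma; [move=> ? ?; exact: sub_sigma_algebra|case: (LP k)].
have mC : measurable (C : set (PS X S)).
  by apply: (@closed_sigma (TS S) (cylinders X S)) cC => ?;
     exact: open_measurable_PS.
have mU : measurable (U : set (PS X S)) by exact: open_measurable_PS.
have BE : ~` (box L : set (PS X S)) =
    \big[setU/set0]_(k : {k | k \in S}) ((fun x : PS X S => x k) @^-1` (~` L k)).
  rewrite -bigcup_seq; apply/seteqP; split => [x /existsNP[k nLk]|x [k _ nLk] Lx].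
    by exists k => //=; rewrite mem_index_enum.
  exact: nLk.
have mB : measurable (~` (box L : set (PS X S))).
  by rewrite BE; apply: bigsetU_measurable.
exists (box L `&` C); split.
- exact: compact_closedI.
- apply: (@measurableI _ (PS X S)) => //.
  by rewrite -[box L]setCK; exact: measurableC.
- by move=> x [_ /CA].
rewrite -lee_fin fineK; last first.
  apply: fin_num_measure; apply: measurableD => //.
  by apply: measurableI => //; rewrite -[box L]setCK; exact: measurableC.
apply: (@le_trans _ _ (P ((~` (box L : set (PS X S))) `|` (U `\` C)))).
  apply: le_measure; rewrite ?inE.
  - apply: measurableD => //.
    by apply: measurableI => //; rewrite -[box L]setCK; exact: measurableC.
  - by apply: measurableU => //; exact: measurableD.
  - move=> x [Ax nKC]; have [Cx|nCx] := pselect (C x).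
      by left => Lx; apply: nKC.
    by right; split => //; exact: AU.
apply: le_trans (measureU2 P _ _) _ => //; first exact: measurableD.
rewrite [leRHS](_ : _ = (e / 2)%:E + (e / 2)%:E)%E; last by rewrite -EFinD -splitr.
apply: leeD; last first.
  rewrite -[leLHS]fineK ?lee_fin//; apply: fin_num_measure; exact: measurableD.
rewrite BE; apply: le_trans (measure_bigsetU_le P _ _ mL) _.
apply: (@le_trans _ _ (\sum_(k : {k | k \in S})
    (e / 2 / (#|{: {k | k \in S}}|.+1)%:R)%:E)%E).
  apply: lee_sum => k _.
  rewrite -[leLHS]fineK ?lee_fin; first exact: LE.
  exact: fin_num_measure.
rewrite sumEFin lee_fin sumr_const -[leLHS]mulr_natr -[leLHS]mulrA.
rewrite ler_piMr ?(ltW e20)// mulrC ler_pdivrMr// mul1r ler_nat.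
exact: leqW (max_card _).
Qed.

End product_regular.

(** * Kantorovich duality *)

Section probability_of_set_function.
Context {R : realType} {T : pointedType} (H : set (set T)) (P : set T -> \bar R).
Hypotheses (P0 : P set0 = 0) (P_ge0 : forall B, (0 <= P B)%E) (PT : P setT = 1%E).
Hypothesis P_sigma : forall F : (set T)^nat, (forall n, <<s H >> (F n)) ->
  trivIset setT F ->
  (\sum_(0 <= i < n) P (F i))%E @[n --> \oo] --> P (\bigcup_n F n).

Let Q : set (g_sigma_algebraType H) -> \bar R := P.

Let Q_sigma : semi_sigma_additive Q.
Proof. by move=> F mF tF _; exact: P_sigma. Qed.

HB.instance Definition _ := isMeasure.Build _ _ R Q P0 P_ge0 Q_sigma.
HB.instance Definition _ := Measure_isProbability.Build _ _ R Q PT.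

(** Turns the Caratheodory extension, which lives on a larger sigma-algebra, into a probability on
    the product sigma-algebra. *)
Lemma probability_of_set_function :
  exists m : probability (g_sigma_algebraType H) R, forall A, m A = P A.
Proof. by exists (Q : probability _ _). Qed.

End probability_of_set_function.

Lemma null_bigcup {d} {T : measurableType d} {R : realType}
    (P : {measure set T -> \bar R}) (A : set T) (F : (set T)^nat) :
  measurable A -> (forall n, measurable (F n)) -> (forall n, P (F n) = 0%E) ->
  A `<=` \bigcup_n F n -> P A = 0%E.
Proof.
move=> mA mF F0 AF; apply/eqP; rewrite eq_le measure_ge0 andbT.
apply: le_trans (measure_sigma_subadditive P mF mA AF) _.
by rewrite eseries0.
Qed.

Section integrable_affine.
Context {d} {T : measurableType d} {R : realType}.
Variables (P : probability T R) (a : R) (f g : T -> R).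
Hypothesis intf : P.-integrable setT (EFin \o f).

Let intZ : P.-integrable setT (EFin \o (fun x => a * f x)).
Proof.
rewrite (_ : EFin \o _ = fun x => (a%:E * (EFin \o f) x)%E); first exact: integrableZl.
by apply/funext => x; rewrite /= EFinM.
Qed.

Hypothesis intg : P.-integrable setT (EFin \o g).

Lemma integrable_affine : P.-integrable setT (EFin \o (fun x => a * f x + g x)).
Proof.
rewrite (_ : EFin \o _ = ((EFin \o (fun x => a * f x)%R) \+ (EFin \o g))%E).
  exact: integrableD.
by apply/funext => x; rewrite /= EFinD.
Qed.

Lemma Rintegral_affine : (\int[P]_x (a * f x + g x) =
  a * \int[P]_x (f x) + \int[P]_x (g x))%R.
Proof. by rewrite RintegralD//; congr (_ + _); rewrite RintegralZl. Qed.

Lemma probability_integrable_cst (r : R) : P.-integrable setT (EFin \o (fun=> r)).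
Proof. exact: finite_measure_integrable_cst. Qed.

Lemma probability_Rintegral_cst (r : R) : (\int[P]_x r = r)%R.
Proof.
transitivity (r * fine (P setT)); first exact: Rintegral_cst.
by rewrite probability_setT mulr1.
Qed.

Lemma probability_Rintegral_indic (A : set T) : measurable A ->
  (\int[P]_x (\1_A x) = fine (P A))%R.
Proof. by move=> mA; rewrite /Rintegral integral_indic// setIT. Qed.

End integrable_affine.

Lemma xcoordE {N : nat} {X : 'I_N -> Type} (x : prodS X [set: 'I_N]%SET)
  (k : sidx [set: 'I_N]%SET) : x k = xcoord x (sval k).
Proof.
case: k => k hk; rewrite /xcoord /=.
by rewrite (bool_irrelevance hk (finset.in_setT k)).
Qed.

Section duality.
Context {R : realType} {N : nat} {X : 'I_N -> completePseudoMetricType R}.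
Hypothesis N0 : (0 < N)%N.
Variable mu : forall k : 'I_N, probability (borel (X k)) R.
Variable c : prodS X [set: 'I_N]%SET -> R.
Variable phi : forall k : 'I_N, X k -> R.
Hypothesis phi_int : forall k, (mu k).-integrable setT (EFin \o phi k).
Hypothesis phi_adm : forall x, \sum_(k < N) phi k (xcoord x k) <= c x.
Hypothesis phi_opt : forall psi : forall k : 'I_N, X k -> R,
  (forall k, (mu k).-integrable setT (EFin \o psi k)) ->
  (forall x, \sum_(k < N) psi k (xcoord x k) <= c x) ->
  (\sum_(k < N) \int[mu k]_x (psi k x)%:E
     <= \sum_(k < N) \int[mu k]_x (phi k x)%:E)%E.

Local Notation Y := (prodS X [set: 'I_N]%SET).
Local Notation potential := (forall k : 'I_N, X k -> R).

Definition slack (x : Y) : R := c x - \sum_(k < N) phi k (xcoord x k).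

Lemma slack_ge0 x : 0 <= slack x.
Proof. by rewrite subr_ge0. Qed.

Let J (psi : potential) : R := \sum_(k < N) \int[mu k]_x (psi k x).

Let integrable_family (psi : potential) :=
  forall k, (mu k).-integrable setT (EFin \o psi k).

Let JE psi : integrable_family psi ->
  (\sum_(k < N) \int[mu k]_x (psi k x)%:E)%E = (J psi)%:E.
Proof.
move=> ipsi; rewrite -sumEFin; apply: eq_bigr => k _.
by rewrite /Rintegral fineK//; exact: integrable_fin_num.
Qed.

Let integrable_lin a psi chi : integrable_family psi -> integrable_family chi ->
  integrable_family (fun k x => a * psi k x + chi k x).
Proof.
move=> ipsi ichi k.
exact: (integrable_affine (mu k) a (psi k) (chi k) (ipsi k) (ichi k)).
Qed.

Let J_lin a psi chi : integrable_family psi -> integrable_family chi ->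
  J (fun k x => a * psi k x + chi k x) = a * J psi + J chi.
Proof.
move=> ipsi ichi; rewrite /J mulr_sumr -big_split/=; apply: eq_bigr => k _.
exact: (Rintegral_affine (mu k) a (psi k) (chi k) (ipsi k) (ichi k)).
Qed.

(** [psi + phi] is admissible in the dual problem, so [psi] cannot improve on the maximizer
    [phi]. *)
Let J_le0 psi : integrable_family psi ->
  (forall x, \sum_(k < N) psi k (xcoord x k) <= slack x) -> J psi <= 0.
Proof.
move=> ipsi hpsi.
have := phi_opt (fun k x => 1 * psi k x + phi k x)
  (integrable_lin 1 _ _ ipsi phi_int).
rewrite !JE ?J_lin//; last exact: integrable_lin.
rewrite lee_fin mul1r gerDr; apply => x.
under eq_bigr do rewrite mul1r.
by rewrite big_split/= -lerBrDr; exact: hpsi.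
Qed.

(* Multiples of the slack are given weight zero: the finitely additive plan
   obtained by Hahn-Banach then vanishes on every set [slack >= e], so that
   unbounded costs need no truncation. *)
Let cone : set ((Y -> R) * R) := [set u | exists psi t,
  [/\ integrable_family psi, 0 <= t,
      forall x, u.1 x = \sum_(k < N) psi k (xcoord x k) + t * slack x &
      u.2 = J psi]].

Let coneD v a w b : cone (v, a) -> cone (w, b) ->
  cone (fun x => v x + w x, a + b).
Proof.
move=> [psi [t [ipsi t0 /= vE ->]]] [chi [s [ichi s0 /= wE ->]]].
exists (fun k x => 1 * psi k x + chi k x), (t + s); split => /=.
- exact: integrable_lin.
- exact: addr_ge0.
- move=> x; rewrite vE wE mulrDl addrACA -big_split/=; congr (_ + _).
  by apply: eq_bigr => k _; rewrite mul1r.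
- by rewrite J_lin// mul1r.
Qed.

Let i0 : integrable_family (fun _ _ => 0).
Proof. by move=> k; exact: probability_integrable_cst. Qed.

Let J0 : J (fun _ _ => 0) = 0.
Proof. by rewrite /J big1// => k _; exact: probability_Rintegral_cst. Qed.

Let coneZ t v a : 0 < t -> cone (v, a) -> cone (fun x => t * v x, t * a).
Proof.
move=> t0 [psi [s [ipsi s0 /= vE ->]]].
exists (fun k x => t * psi k x + 0), (t * s); split => /=.
- exact: integrable_lin.
- by rewrite mulr_ge0// ltW.
- move=> x; rewrite vE mulrDr mulrA mulr_sumr; congr (_ + _).
  by apply: eq_bigr => k _; rewrite addr0.
- by rewrite J_lin// J0 addr0.
Qed.

Let single (k : 'I_N) (g : X k -> R) : potential :=
  dfwith (fun j => (fun=> 0) : X j -> R) k g.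

Let single_sum k g (x : Y) :
  \sum_(j < N) single k g j (xcoord x j) = g (xcoord x k).
Proof.
rewrite (bigD1 k)//= /single dfwithin big1 ?addr0// => j jk.
by rewrite dfwithout// eq_sym.
Qed.

Let single_int k g : (mu k).-integrable setT (EFin \o g) ->
  integrable_family (single k g).
Proof. by move=> ig j; rewrite /single; case: dfwithP => //= i _; exact: i0. Qed.

Let single_J k g : J (single k g) = \int[mu k]_x (g x).
Proof.
rewrite /J (bigD1 k)//= /single dfwithin big1 ?addr0// => j jk.
by rewrite dfwithout 1?eq_sym//; exact: probability_Rintegral_cst.
Qed.

Let cone_single k g : (mu k).-integrable setT (EFin \o g) ->
  cone (fun x => g (xcoord x k), \int[mu k]_x (g x)).
Proof.
move=> ig; exists (single k g), 0; split => //=; first exact: single_int.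
by move=> x; rewrite single_sum mul0r addr0.
Qed.

Let cone_cst a : cone (fun=> a, a).
Proof.
(* The constant is charged to the potential of a single coordinate. *)
have k : 'I_N by exact: Ordinal N0.
have := cone_single k (fun=> a) (probability_integrable_cst (mu k) a).
by rewrite probability_Rintegral_cst.
Qed.

Let cone_slack t : 0 <= t -> cone (fun x => t * slack x, 0).
Proof.
move=> t0; exists (fun _ _ => 0), t; split => //= x.
by rewrite big1 ?add0r.
Qed.

(** If [t > 0], the potentials [- psi / t] sum to at most the slack; if [t = 0], those of [- psi]
    sum to at most 0, hence to at most the slack. In both cases [J_le0] applies. *)
Let cone_ge0 v a : (forall x, 0 <= v x) -> cone (v, a) -> 0 <= a.
Proof.
move=> v0 [psi [t [ipsi t0 /= vE ->]]].
have [te0|tn0] := eqVneq t 0.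
  suff : J (fun k x => (-1) * psi k x + 0) <= 0.
    by rewrite J_lin// J0; lra.
  apply: J_le0 => [|x]; first exact: integrable_lin.
  apply: le_trans (slack_ge0 x).
  have := v0 x; rewrite vE te0 mul0r addr0 => psi0.
  under eq_bigr do rewrite addr0.
  by rewrite -mulr_sumr mulN1r oppr_le0.
have tp : 0 < t by rewrite lt_def tn0.
suff : J (fun k x => (- t^-1) * psi k x + 0) <= 0.
  by rewrite J_lin// J0 addr0 mulNr oppr_le0 pmulr_rge0// invr_gt0.
apply: J_le0 => [|x]; first exact: integrable_lin.
under eq_bigr do rewrite addr0.
rewrite -mulr_sumr mulNr lerNl -(ler_pM2l tp) mulrN mulrA mulfV// mul1r.
by have := v0 x; rewrite vE; lra.
Qed.

(** The indicator of a cylinder over [A] is in the cone at price [mu k A], which bounds the marginal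
    from above; the same bound for the complement gives equality. On a set where the slack is at
    least [e], the indicator is below [e^-1 * slack], which has price 0. *)
Lemma finitely_additive_plan : exists nu : set Y -> R,
  [/\ forall A, 0 <= nu A, nu setT = 1,
      forall A B, A `&` B = set0 -> nu (A `|` B) = nu A + nu B,
      forall k (A : set (X k)), <<s @open (X k) >> A ->
        nu [set x | A (xcoord x k)] = fine (mu k A) &
      forall (A : set Y) e, 0 < e -> (forall x, A x -> e <= slack x) -> nu A = 0].
Proof.
have [nu [nu0 nuT nuU nuC]] := cone_content cone coneD coneZ cone_cst cone_ge0.
exists nu; split => //.
- move=> k A mA.
  have le B : <<s @open (X k) >> B -> nu [set x | B (xcoord x k)] <= fine (mu k B).
    move=> mB; have iB : (mu k).-integrable setT (EFin \o (\1_B : X k -> R)).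
      exact: integrable_indic.
    have := cone_single k \1_B iB.
    rewrite (probability_Rintegral_indic (mu k))// => /nuC; apply => x.
    by rewrite !indicE.
  apply/eqP; rewrite eq_le le//=.
  have mAC : <<s @open (X k) >> (~` A) by exact: sigma_algebraC.
  have := le _ mAC; rewrite (@probability_setC _ (borel (X k)) R (mu k) A mA).
  rewrite fineB ?fin_num_measure//=.
  have := nuU [set x | A (xcoord x k)] [set x | (~` A) (xcoord x k)].
  rewrite -[X in nu X = _](_ : setT = _); last first.
    by apply/seteqP; split => // x _; exact: EM.
  rewrite nuT => ->; last by apply/seteqP; split => // x [].
  lra.
- move=> A e e0 Ae; apply/eqP; rewrite eq_le nu0 andbT.
  have ie0 : 0 <= e^-1 by rewrite invr_ge0 ltW.
  apply: nuC (cone_slack _ ie0) _ => x; rewrite indicE.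
  case: (boolP (x \in A)) => [/set_mem/Ae ex|_] /=.
    by rewrite mulrC ler_pdivlMr// mul1r.
  by rewrite mulr_ge0// slack_ge0.
Qed.

End duality.

(** * A countably additive coupling with zero slack *)

Section optimal_coupling.
Context {R : realType} {N : nat} {X : 'I_N -> completePseudoMetricType R}.
Hypothesis sepX : forall k, separable_space (X k).
Variable mu : forall k : 'I_N, probability (borel (X k)) R.
Variable c : prodS X [set: 'I_N]%SET -> R.
Hypothesis c_lsc : lower_semicontinuous
  (fun x : prod_topology (fun k : sidx [set: 'I_N]%SET => X (sval k)) => (c x)%:E).
Variable phi : forall k : 'I_N, X k -> R.
Hypothesis phi_int : forall k, (mu k).-integrable setT (EFin \o phi k).

Local Notation Y := (prodS X [set: 'I_N]%SET).
Local Notation PY := (PS X [set: 'I_N]%SET).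
Local Notation TY := (TS (X := X) [set: 'I_N]%SET).

Lemma open_lsc (q : R) : open ([set x | q < c x] : set TY).
Proof. by have /lower_semicontinuousP := c_lsc; exact. Qed.

Lemma measurable_xcoord (k : 'I_N) (A : set (borel (X k))) : measurable A ->
  measurable ([set x | A (xcoord x k)] : set PY).
Proof. by exact: (measurable_coord _ (exist _ k (finset.in_setT k))). Qed.

Lemma measurable_fun_xcoord (k : 'I_N) :
  measurable_fun setT ((fun x : PY => xcoord x k) : PY -> borel (X k)).
Proof. by move=> _ A mA; rewrite setTI; exact: measurable_xcoord. Qed.

Lemma measurable_phi (k : 'I_N) : measurable_fun setT (phi k : borel (X k) -> R).
Proof. by apply/measurable_EFinP; exact: measurable_int (phi_int k). Qed.

Lemma measurable_cost : measurable_fun setT (c : PY -> R).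
Proof.
apply: (measurability _ (RGenOInfty.measurableE R)).
move=> _ [_ [q ->] <-]; rewrite setTI preimage_itvoy.
exact: (open_measurable_PS sepX _ _ (open_lsc q)).
Qed.

Lemma measurable_slack : measurable_fun setT (slack c phi : PY -> R).
Proof.
apply: measurable_funB; first exact: measurable_cost.
apply: measurable_sum => k.
exact: (measurableT_comp (measurable_phi k) (measurable_fun_xcoord k)).
Qed.

(** Rationals separate [c] from the potentials: the set of positive slack is a countable union of
    pieces, each the intersection of an open set with cylinders and each with slack bounded away
    from 0. *)
Let piece (q0 : rat) (q : {ffun 'I_N -> rat}) : set Y :=
  [set x | ratr q0 < c x /\ forall k, phi k (xcoord x k) < ratr (q k)].

Let separated (n : nat) (q0 : rat) (q : {ffun 'I_N -> rat}) :=
  \sum_(k < N) ratr (q k) + n.+1%:R^-1 <= ratr q0 :> R.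

Let piece_slack n q0 q x : separated n q0 q -> piece q0 q x ->
  n.+1%:R^-1 <= slack c phi x.
Proof.
move=> sep [q0c phiq]; rewrite /slack.
have : \sum_(k < N) phi k (xcoord x k) <= \sum_(k < N) ratr (q k).
  by apply: ler_sum => k _; exact/ltW.
have aux (S T r cx e : R) : S + e <= r -> r < cx -> T <= S -> e <= cx - T by lra.
exact: aux sep q0c.
Qed.

Let slack_gt0_piece x : 0 < slack c phi x ->
  exists n q0 q, separated n q0 q /\ piece q0 q x.
Proof.
move=> s0; set s := slack c phi x in s0.
(* A quarter of the slack is allotted to each of the gap, the rational below [c x], and the sum of
   the rationals above the potentials. *)
have s40 : 0 < s / 4 by rewrite divr_gt0.
have [n] := ltr_add_invr s40; rewrite add0r => ns.
have dN : 0 < s / 4 / N.+1%:R by rewrite divr_gt0.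
have hq (k : 'I_N) : exists r : rat, ratr r \in
    `]phi k (xcoord x k), phi k (xcoord x k) + s / 4 / N.+1%:R[.
  have [r hr] : exists r : rat, ratr r \in
      `]phi k (xcoord x k), phi k (xcoord x k) + s / 4 / N.+1%:R[.
    by apply: rat_in_itvoo; rewrite ltrDl.
  by exists r.
have cs : c x - s / 4 < c x by rewrite ltrBlDr ltrDl.
have [r0] := rat_in_itvoo cs.
rewrite in_itv/= => /andP[r0c cr0].
have [r hr] := choice hq.
exists n, r0, (finfun r); split; last first.
  split => // k; rewrite ffunE; have := hr k.
  by rewrite in_itv/= => /andP[].
have : \sum_(k < N) ratr (finfun r k) <=
    \sum_(k < N) phi k (xcoord x k) + s / 4.
  apply: (@le_trans _ _ (\sum_(k < N) (phi k (xcoord x k) + s / 4 / N.+1%:R))).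
    apply: ler_sum => k _; rewrite ffunE; have := hr k.
    by rewrite in_itv/= => /andP[_ /ltW].
  rewrite big_split/= lerD2l sumr_const card_ord -[leLHS]mulr_natr.
  by rewrite -[leLHS]mulrA ler_piMr ?(ltW s40)// mulrC ler_pdivrMr// mul1r ler_nat.
have aux (S U cx t e s' : R) : 0 < s' -> s' = cx - U -> e < s' / 4 -> cx - s' / 4 < t ->
  S <= U + s' / 4 -> S + e <= t by lra.
exact: aux s0 erefl ns r0c.
Qed.

Hypothesis N0 : (0 < N)%N.
Hypothesis phi_adm : forall x, \sum_(k < N) phi k (xcoord x k) <= c x.
Hypothesis phi_opt : forall psi : forall k : 'I_N, X k -> R,
  (forall k, (mu k).-integrable setT (EFin \o psi k)) ->
  (forall x, \sum_(k < N) psi k (xcoord x k) <= c x) ->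
  (\sum_(k < N) \int[mu k]_x (psi k x)%:E
     <= \sum_(k < N) \int[mu k]_x (phi k x)%:E)%E.

Lemma zero_slack_coupling : exists lam : probability PY R,
  coupling mu lam /\ lam [set x | 0 < slack c phi x] = 0%E.
Proof.
have [nu [nu0 nuT nuU nuM nuS]] :=
  finitely_additive_plan N0 mu c phi phi_int phi_adm phi_opt.
have nuC (k : sidx [set: 'I_N]%SET) (A : set (X (sval k))) :
    <<s @open (X (sval k)) >> A ->
    nu ((fun x : TY => x k) @^-1` A) = fine (mu (sval k) A).
  move=> mA; rewrite -nuM//; congr nu; apply/seteqP.
  by split => x /=; rewrite (xcoordE x k).
have nu_mono (A B : set TY) : A `<=` B -> nu A <= nu B.
  move=> AB; rewrite -(setUIDK B A) (setIidr AB) nuU ?lerDl//.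
  by rewrite setDE setICA setICr setI0.
have nu_sub (A B : set TY) : nu (A `|` B) <= nu A + nu B.
  rewrite (_ : A `|` B = A `|` (B `\` A)); last first.
    apply/seteqP; split => x; last by move=> [|[]]; [left|right].
    by move=> [|Bx]; [left|have [|] := pselect (A x); [left|right]].
  rewrite nuU; last by rewrite setDE setICA setICr setI0.
  by rewrite lerD2l; apply: nu_mono => x [].
(* Tightness is inherited from the marginals through a box of compacts, by finite subadditivity
   alone. *)
have tight e : 0 < e -> exists2 K : set TY, compact K & nu (~` K) <= e.
  move=> e0; have eN0 : 0 < e / N.+1%:R by rewrite divr_gt0.
  have hK k := polish_tight (mu k) (sepX k) _ eN0.
  pose L k : set (X k) := s2val (cid2 (hK k)).
  have LP k : compact (L k) /\ closed (L k) by rewrite /L; case: (cid2 _).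
  have LE k : fine (mu k (~` L k)) <= e / N.+1%:R.
    by rewrite /L; case: (cid2 _).
  exists (box (fun k : {k | k \in [set: 'I_N]%SET} => L (sval k))).
    by apply: compact_box => k; case: (LP (sval k)).
  apply: (@le_trans _ _ (\sum_(k < N) nu [set x | (~` L k) (xcoord x k)])).
    apply: (@le_trans _ _ (nu (\big[setU/set0]_(k < N) [set x | (~` L k) (xcoord x k)]))).
      apply: nu_mono => x /existsNP[k nLk].
      rewrite -bigcup_seq; exists (sval k); first by rewrite /= mem_index_enum.
      by rewrite /= -xcoordE.
    elim: (index_enum _) => [|k s ih].
      by rewrite !big_nil -[leRHS](nuS set0 1).
    by rewrite !big_cons; apply: le_trans (nu_sub _ _) _; rewrite lerD2l.
  apply: (@le_trans _ _ (\sum_(k < N) e / N.+1%:R)).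
    apply: ler_sum => k _; rewrite nuM; first exact: LE.
    apply: sigma_algebraC; apply: closed_sigma; last by case: (LP k).
    by move=> ? ?; exact: sub_sigma_algebra.
  rewrite sumr_const card_ord -[leLHS]mulr_natr mulrAC -mulrA.
  by rewrite ler_piMr ?(ltW e0)// ler_pdivrMr// mul1r ler_nat.
pose t := TightContent R TY nu nu0 nuU tight.
have [P [P0 P_ge0 Psig Pnu]] := tight_content_extension t.
have reg_coord (k : sidx [set: 'I_N]%SET) A : <<s @open (X (sval k)) >> A ->
    regular_for t ((fun x : TY => x k) @^-1` A).
  move=> mA; apply: (regular_coord _ _ (fun B => fine (mu (sval k) B))) => //.
    by move=> B mB; rewrite /= nuC.
  exact: borel_regular.
(* The product sigma-algebra lies in the domain of countable additivity of [P]. *)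
have cylP : <<s cylinders X [set: 'I_N]%SET >> `<=` <<s regular_for t >>.
  apply: sub_sigma_algebra2 => _ [k [A [mA ->]]]; exact: reg_coord.
have [||m mP] := @probability_of_set_function R Y (cylinders X [set: 'I_N]%SET) P P0 P_ge0.
- by rewrite Pnu; [rewrite /= nuT|exact: regular_forT].
- by move=> F mF tF; apply: Psig => // n; exact: cylP.
exists m; split.
  move=> k A mA; rewrite mP Pnu; last exact: reg_coord.
  by rewrite /= nuC// fineK// fin_num_measure.
(* Regularity is at hand for finite intersections of cylinders, so the open set where [c] exceeds
   [ratr q] is decomposed into countably many open boxes. *)
have /choice[AD hAD] : forall q : rat, exists AD : (nat ->
    forall i : {k | k \in [set: 'I_N]%SET}, set (X (sval i))) * set nat,
    (forall n i, open (AD.1 n i)) /\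
    ([set x | ratr q < c x] = \bigcup_(n in AD.2) box (AD.1 n)).
  move=> q; have [|A [D AP]] := @open_countable_boxes _
    (fun k : {k | k \in [set: 'I_N]%SET} => X (sval k)) _ _ (open_lsc (ratr q)).
    by move=> i; exact: separable_countable_base.
  by exists (A, D).
(* Enumerates, over all separated rational data, the parts of the pieces that lie in one open box;
   every other code gives the empty set. *)
pose E (i : nat) : set PY :=
  if @unpickle (nat * rat * {ffun 'I_N -> rat} * nat)%type i is Some (n, q0, q, j)
  then if `[< separated n q0 q /\ (AD q0).2 j >]
       then box ((AD q0).1 j) `&`
            \big[setI/setT]_(k < N) [set x | phi k (xcoord x k) < ratr (q k)]
       else set0
  else set0.
have mphi (k : 'I_N) q : <<s @open (X k) >> [set x | phi k x < ratr q].
  have := measurable_phi k measurableT `]-oo, (ratr q : R)[%classic.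
  by rewrite preimage_itvNyo setTI; apply; exact: measurable_itv.
have bopen (q : rat) j k : <<s @open (X (sval k)) >> ((AD q).1 j k).
  by apply: sub_sigma_algebra; exact: (hAD q).1.
have mE i : measurable (E i).
  rewrite /E; case: unpickle => // -[[[n q0] q] j]; case: asboolP => // _.
  apply: measurableI; last first.
    by apply: (@bigsetI_measurable _ PY) => k _;
      exact: (measurable_coord _ (exist _ k (finset.in_setT k)) _ (mphi k (q k))).
  rewrite boxE; apply: (@bigsetI_measurable _ PY) => k _; exact: measurable_coord.
have rE i : regular_for t (E i).
  have r0 : regular_for t set0 by exact: (@measurable0 _ (regular_algebra t)).
  rewrite /E; case: unpickle => // -[[[n q0] q] j]; case: asboolP => // _.
  apply: (@measurableI _ (regular_algebra t)); last first.
    by apply: (@bigsetI_measurable _ (regular_algebra t)) => k _;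
      exact: (reg_coord (exist _ k (finset.in_setT k)) _ (mphi k (q k))).
  by rewrite boxE; apply: (@bigsetI_measurable _ (regular_algebra t)) => k _;
    exact: reg_coord.
apply: (null_bigcup m _ E) => //.
- have := measurable_slack measurableT `]0, +oo[%classic.
  by rewrite preimage_itvoy setTI; apply; exact: measurable_itv.
- move=> i; transitivity (P (E i)); first exact: mP.
  rewrite (Pnu _ (rE i)) /=.
  rewrite /E; case: unpickle => [[[[n q0] q] j]|]; last by rewrite (nuS _ 1).
  case: asboolP => [[sep jD]|_]; last by rewrite (nuS _ 1).
  rewrite (nuS _ (n.+1%:R^-1)) ?invr_gt0// => x [bx].
  rewrite -bigcap_seq => phix; apply: (piece_slack n q0 q x sep); split.
    suff : [set x | ratr q0 < c x] x by [].
    by rewrite (hAD q0).2; exists j.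
  by move=> k; apply: (phix k); rewrite /= mem_index_enum.
- move=> x /slack_gt0_piece[n [q0 [q [sep [q0c phix]]]]].
  have : [set x | ratr q0 < c x] x by [].
  rewrite (hAD q0).2 => -[j jD bx].
  exists (pickle (n, q0, q, j)) => //; rewrite /E pickleK.
  case: asboolP => [_|]; last by move=> /(_ (conj sep jD)).
  by split => //; rewrite -bigcap_seq => k _; exact: phix.
Qed.

End optimal_coupling.

(** * Optimality in the full and in the reduced problems *)

(** The integral is built from suprema over simple functions, hence is monotone on arbitrary
    functions. This allows comparisons with [cS], an infimum whose measurability is not
    established. *)
Lemma le_integral_total {d} {T : measurableType d} {R : realType}
    (P : {measure set T -> \bar R}) (f g : T -> \bar R) :
  (forall x, (f x <= g x)%E) -> (\int[P]_x f x <= \int[P]_x g x)%E.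
Proof.
move=> fg; have fgT x : ((f \_ setT) x <= (g \_ setT) x)%E.
  by rewrite !patch_setT; exact: fg.
rewrite /integral; apply: leeB; apply: le_ereal_sup => _ [h hf <-];
  exists h => // x; apply: le_trans (hf x) _.
- by apply: (@funepos_le _ _ setT) => [y _|]; rewrite ?in_setT.
- by apply: (@funeneg_le _ _ setT) => [y _|]; rewrite ?in_setT.
Qed.

Section glue_lemmas.
Context {N : nat} {X : 'I_N -> Type}.

Lemma glue_l {S T U : {set 'I_N}} (hU : U \subset S :|: T) (x : prodS X S)
  (y : prodS X T) (k : 'I_N) (kU : k \in U) (kS : k \in S) :
  Defs.glue hU x y (exist _ k kU) = x (exist _ k kS).
Proof.
rewrite /Defs.glue /=.
(* The equation is generalized first, so that the dependent conditional of [glue] can be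
   destructed. *)
move: (erefl (k \in S)); case: {2 3}(k \in S) => e.
  by rewrite (bool_irrelevance e kS).
by exfalso; rewrite kS in e.
Qed.

Lemma glue_r {S T U : {set 'I_N}} (hU : U \subset S :|: T) (x : prodS X S)
  (y : prodS X T) (k : 'I_N) (kU : k \in U) (kT : k \in T) : k \notin S ->
  Defs.glue hU x y (exist _ k kU) = y (exist _ k kT).
Proof.
move=> kS; rewrite /Defs.glue /=.
move: (erefl (k \in S)); case: {2 3}(k \in S) => e.
  by exfalso; rewrite e in kS.
by rewrite (bool_irrelevance (glue_aux hU k _ _) kT).
Qed.

Lemma prjE {S T : {set 'I_N}} (h : S \subset T) (x : prodS X T) (k : 'I_N)
  (kS : k \in S) (kT : k \in T) : prj h x (exist _ k kS) = x (exist _ k kT).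
Proof.
by rewrite /prj /= (bool_irrelevance (fintype.subsetP h k _) kT).
Qed.

Lemma prodS_ext {S : {set 'I_N}} (x y : prodS X S) : (forall k, x k = y k) -> x = y.
Proof. by move=> xy; apply: functional_extensionality_dep. Qed.

Lemma glue_prj (S : {set 'I_N}) (z : prodS X [set: 'I_N]%SET) :
  Defs.glue (subT_setUCr S) (prj (finset.subsetT S) z) (prj (finset.subsetT (~: S)) z) = z.
Proof.
apply: prodS_ext => -[k kT]; have [kS|kS] := boolP (k \in S).
  by rewrite (glue_l _ _ _ _ kT kS) (prjE _ _ _ kS kT).
have kC : k \in ~: S by rewrite inE.
by rewrite (glue_r _ _ _ _ kT kC kS) (prjE _ _ _ kC kT).
Qed.

End glue_lemmas.

Section projection_continuous.
Context {R : realType} {N : nat} {X : 'I_N -> completePseudoMetricType R}.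

Lemma measurable_pprj (S T : {set 'I_N}) (h : S \subset T) :
  measurable_fun setT (pprj h : PS X T -> PS X S).
Proof.
apply: (@measurability _ _ (PS X T) (PS X S) _ _ (cylinders X S)) => //.
move=> _ [_ [k [A [mA ->]]] <-]; rewrite setTI.
exact: (measurable_coord _ (exist _ (sval k) (fintype.subsetP h _ (svalP k)))).
Qed.

Lemma continuous_prj (S T : {set 'I_N}) (h : S \subset T) :
  continuous (@prj N (fun k => X k) S T h : TS (X := X) T -> TS (X := X) S).
Proof.
apply/continuousP => U oU; rewrite openE => x Ux.
have [A [oA Ax AU]] := open_box_nbhs _ _ oU Ux.
have hA (k : {k | k \in S}) : \forall y \near x, A k (@prj N (fun k => X k) S T h y k).
  apply: (@open_nbhs_nbhs (TS T)); split; last exact: Ax.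
  exact: (@open_coord _ (fun k : {k | k \in T} => X (sval k))
    (exist _ (sval k) (fintype.subsetP h _ (svalP k))) _ (oA k)).
by rewrite /interior; apply: filterS (filter_forall _ hA) => y Ay; exact: AU.
Qed.

End projection_continuous.

Section coupling_integral.
Context {R : realType} {N : nat} {X : 'I_N -> completePseudoMetricType R}.
Variable mu : forall k : 'I_N, probability (borel (X k)) R.
Variable phi : forall k : 'I_N, X k -> R.
Hypothesis phi_int : forall k, (mu k).-integrable setT (EFin \o phi k).
Variables (S : {set 'I_N}) (tau : probability (PS X S) R).
Hypothesis ctau : coupling mu tau.

Definition potential_sum (S : {set 'I_N}) (y : prodS X S) : R :=
  \sum_(k : {k | k \in S}) phi (sval k) (y k).

Let F (k : {k | k \in S}) (y : PS X S) : \bar R := (phi (sval k) (y k))%:E.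

Let mF k : measurable_fun setT (F k).
Proof.
exact: (measurableT_comp (measurable_int _ (phi_int (sval k))) (measurable_fun_coord S k)).
Qed.

Let law_int (k : {k | k \in S}) (g : borel (X (sval k)) -> \bar R) :
  (\int[pushforward tau (fun y : PS X S => y k : borel (X (sval k)))]_x g x =
   \int[mu (sval k)]_x g x)%E.
Proof.
transitivity (\int[law tau _ (measurable_fun_coord S k)]_x g x)%E; first by [].
by apply: eq_measure_integral => A mA _; exact: ctau.
Qed.

Let F_int k : tau.-integrable setT (F k).
Proof.
apply/integrableP; split; first exact: mF.
have /integrableP[mp] := phi_int (sval k).
apply: le_lt_trans; rewrite -law_int ge0_integral_pushforward//.
- exact: measurable_fun_coord.
- exact: measurableT_comp.
Qed.

Let F_integral k : (\int[tau]_y F k y = \int[mu (sval k)]_x (phi (sval k) x)%:E)%E.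
Proof.
rewrite -law_int (integral_pushforward (measurable_fun_coord S k))//.
  exact: (measurable_int _ (phi_int (sval k))).
by rewrite preimage_setT; exact: F_int.
Qed.

Lemma potential_sum_integrable : tau.-integrable setT (EFin \o @potential_sum S).
Proof.
rewrite (_ : EFin \o _ = fun y => (\sum_(k : {k | k \in S}) F k y)%E).
  exact: integrable_sum.
by apply/funext => y; rewrite /= /potential_sum sumEFin.
Qed.

(** The value depends on the marginals only, so it is common to all couplings and serves as the
    benchmark in every optimality comparison. *)
Lemma potential_sum_integral : (\int[tau]_y (@potential_sum S y)%:E =
  \sum_(k : {k | k \in S}) \int[mu (sval k)]_x (phi (sval k) x)%:E)%E.
Proof.
under eq_integral do rewrite /potential_sum -sumEFin.
by rewrite integral_sum//; apply: eq_bigr => k _; exact: F_integral.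
Qed.

End coupling_integral.

Section optimality.
Context {R : realType} {N : nat} {X : 'I_N -> completePseudoMetricType R}.
Hypothesis sepX : forall k, separable_space (X k).
Variable mu : forall k : 'I_N, probability (borel (X k)) R.
Variable c : prodS X [set: 'I_N]%SET -> R.
Hypothesis c_lsc : lower_semicontinuous
  (fun x : prod_topology (fun k : sidx [set: 'I_N]%SET => X (sval k)) => (c x)%:E).
Variable phi : forall k : 'I_N, X k -> R.
Hypothesis phi_int : forall k, (mu k).-integrable setT (EFin \o phi k).
Hypothesis phi_adm : forall x, \sum_(k < N) phi k (xcoord x k) <= c x.

Local Notation Y := (prodS X [set: 'I_N]%SET).
Local Notation PY := (PS X [set: 'I_N]%SET).
Local Notation s := (slack c phi).
Local Notation Phi := (potential_sum phi [set: 'I_N]%SET).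

Lemma slackE (x : Y) : s x = c x - Phi x.
Proof.
rewrite /slack /potential_sum; congr (_ - _).
transitivity (\sum_(k in [set: 'I_N]%SET) phi k (xcoord x k)).
  by apply: eq_bigl => k; rewrite finset.in_setT.
by rewrite big_sub; apply: eq_bigr => k _; rewrite xcoordE.
Qed.

Lemma measurable_pos_slack : measurable ([set x | 0 < s x] : set PY).
Proof.
have := measurable_slack sepX mu c c_lsc phi phi_int measurableT `]0, +oo[%classic.
by rewrite preimage_itvoy setTI; apply; exact: measurable_itv.
Qed.

Section fixed_coupling.
Variable lam : probability PY R.
Hypothesis clam : coupling mu lam.

Let mc : measurable_fun setT (EFin \o (c : PY -> R)).
Proof. by apply/measurable_EFinP; exact: measurable_cost. Qed.

Let Phi_int : lam.-integrable setT (EFin \o (Phi : PY -> R)).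
Proof. exact: potential_sum_integrable phi_int _ _ clam. Qed.

Let mPhi : measurable_fun setT (EFin \o (Phi : PY -> R)).
Proof. exact: measurable_int Phi_int. Qed.

Lemma slack_null_cost : lam [set x | 0 < s x] = 0%E ->
  (\int[lam]_x (c x)%:E = \int[lam]_x (Phi x)%:E)%E.
Proof.
move=> s0; apply: ae_eq_integral => //.
exists [set x | 0 < s x]; split => //; first exact: measurable_pos_slack.
move=> x /= cPhi; rewrite lt_def slack_ge0// andbT.
apply/eqP => sx; apply: cPhi => _; congr EFin.
by apply/eqP; rewrite -subr_eq0 -slackE sx.
Qed.

(** The negative part of [c] is dominated by that of [Phi], and an infinite positive part would
    contradict the bound, so [c] is integrable. The slack is then nonnegative with integral at most
    0. *)
Lemma cost_slack_null : (\int[lam]_x (c x)%:E <= \int[lam]_x (Phi x)%:E)%E ->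
  lam [set x | 0 < s x] = 0%E.
Proof.
move=> cPhi.
have Phifin : (\int[lam]_x (Phi x)%:E)%E \is a fin_num by exact: integrable_fin_num.
have Phi_le_c x : Phi x <= c x by rewrite -subr_ge0 -slackE slack_ge0.
have cneg : (\int[lam]_x (EFin \o c)^\- x < +oo)%E.
  have := integrable_lty measurableT (integrable_funeneg measurableT Phi_int).
  apply: le_lt_trans; apply: le_integral_total => x.
  by apply: (@funeneg_le _ _ setT) => [y _|]; rewrite ?in_setT//= lee_fin.
have cneg0 : (0 <= \int[lam]_x (EFin \o c)^\- x)%E by exact: integral_ge0.
have cnegfin : (\int[lam]_x (EFin \o c)^\- x)%E \is a fin_num by rewrite ge0_fin_numE.
have cpos : (\int[lam]_x (EFin \o c)^\+ x < +oo)%E.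
  rewrite ltey; apply/eqP => cpoo; move: cPhi.
  rewrite integralE cpoo -(fineK cnegfin) -EFinN addye//.
  by rewrite leye_eq => /eqP Poo; rewrite Poo in Phifin.
have c_int : lam.-integrable setT (EFin \o (c : PY -> R)).
  apply/integrableP; split=> //.
  rewrite (_ : (fun x => _) = ((EFin \o c)^\+ \+ (EFin \o c)^\-)%E); last first.
    by rewrite -fune_abse.
  rewrite ge0_integralD//.
  - exact: lte_add_pinfty.
  - exact: measurable_funepos.
  - exact: measurable_funeneg.
have s_int : (\int[lam]_x (s x)%:E = \int[lam]_x (c x)%:E - \int[lam]_x (Phi x)%:E)%E.
  rewrite -integralB_EFin//; apply: eq_integral => x _.
  by rewrite slackE.
have ms : measurable_fun setT (EFin \o (s : PY -> R)).
  by apply/measurable_EFinP; exact: measurable_slack.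
have s_abs0 : (\int[lam]_x `|(EFin \o s) x| = 0)%E.
  under eq_integral do rewrite /= ger0_norm ?slack_ge0//.
  apply/eqP; rewrite eq_le; apply/andP; split; last first.
    by apply: integral_ge0 => x _; rewrite lee_fin slack_ge0.
  by rewrite s_int leeBlDr// add0e.
have [B [mB B0 sB]] := (ae_eq_integral_abs lam measurableT ms).1 s_abs0.
apply/eqP; rewrite eq_le measure_ge0 andbT -B0; apply: le_measure; rewrite ?inE//.
  exact: measurable_pos_slack.
move=> x /= sx; apply: sB => /= /(_ I) -[sx0].
by rewrite sx0 ltxx in sx.
Qed.

End fixed_coupling.

Let Phi_total lam : coupling mu lam -> (\int[lam]_x (Phi x)%:E =
  \sum_(k : {k | k \in [set: 'I_N]%SET}) \int[mu (sval k)]_x (phi (sval k) x)%:E)%E.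
Proof. exact: potential_sum_integral. Qed.

(** The cost of [lam0] equals the integral of [Phi], which is the same for all couplings; an optimal
    plan costs no more, so [cost_slack_null] applies. *)
Lemma optimal_slack_null (lam0 lam : probability PY R) :
  coupling mu lam0 -> lam0 [set x | 0 < s x] = 0%E ->
  optimal_MKP mu c lam -> lam [set x | 0 < s x] = 0%E.
Proof.
move=> c0 s0 [clam /(_ lam0 c0) le_lam]; apply: cost_slack_null => //.
by rewrite Phi_total// -(Phi_total lam0)// -slack_null_cost.
Qed.

End optimality.

(** * Projections of zero-slack couplings solve the reduced problems *)

Section reduced_problem.
Context {R : realType} {N : nat} {X : 'I_N -> completePseudoMetricType R}.
Hypothesis hausX : forall k, hausdorff_space (X k).
Hypothesis sepX : forall k, separable_space (X k).
Variable mu : forall k : 'I_N, probability (borel (X k)) R.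
Variable c : prodS X [set: 'I_N]%SET -> R.
Hypothesis c_lsc : lower_semicontinuous
  (fun x : prod_topology (fun k : sidx [set: 'I_N]%SET => X (sval k)) => (c x)%:E).
Variable phi : forall k : 'I_N, X k -> R.
Hypothesis phi_int : forall k, (mu k).-integrable setT (EFin \o phi k).
Hypothesis phi_adm : forall x, \sum_(k < N) phi k (xcoord x k) <= c x.
Variable S : {set 'I_N}.

Local Notation Y := (prodS X [set: 'I_N]%SET).
Local Notation PY := (PS X [set: 'I_N]%SET).
Local Notation TY := (TS (X := X) [set: 'I_N]%SET).
Local Notation s := (slack c phi).
Local Notation PhiS := (potential_sum phi S).
Local Notation pS := (@pprj N (fun k => X k) S [set: 'I_N]%SET (finset.subsetT S)).

Lemma glue_sum (y : prodS X S) (z : prodS X (~: S)) :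
  \sum_(k < N) phi k (xcoord (Defs.glue (subT_setUCr S) y z) k) =
  PhiS y + \sum_(k in ~: S) phi k (xcoord (Defs.glue (subT_setUCr S) y z) k).
Proof.
rewrite (bigID (mem S))/=; congr (_ + _); last first.
  by apply: eq_bigl => k; rewrite inE.
rewrite big_sub; apply: eq_bigr => -[k kS] _ /=.
by rewrite /xcoord (glue_l _ _ _ _ _ kS).
Qed.

Lemma cS_ge (y : prodS X S) : ((PhiS y)%:E <= cS c phi S y)%E.
Proof.
apply: le_ereal_inf_tmp => _ [z _ <-]; rewrite -EFinB lee_fin lerBrDr.
by rewrite -glue_sum.
Qed.

(** The remaining coordinates of [z] itself compete in the infimum and reach the lower bound of
    [cS_ge]. *)
Lemma cS_prj (z : Y) : s z <= 0 -> cS c phi S (pS z) = (PhiS (pS z))%:E.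
Proof.
move=> sz; apply/eqP; rewrite eq_le cS_ge andbT.
apply: ereal_inf_le; exists ((c z)%:E -
   (\sum_(k in ~: S) phi k (xcoord z k))%:E)%E.
  by exists (prj (finset.subsetT (~: S)) z) => //; rewrite glue_prj.
rewrite -EFinB lee_fin lerBlDr; move: sz; rewrite /slack subr_le0.
have := glue_sum (prj (finset.subsetT S) z) (prj (finset.subsetT (~: S)) z).
by rewrite glue_prj => ->.
Qed.

Lemma coupling_law (lam : probability PY R) : coupling mu lam ->
  coupling mu (law lam pS (measurable_pprj _ _ _)).
Proof.
move=> clam k.
exact: (clam (exist _ (sval k) (fintype.subsetP (finset.subsetT S) _ (svalP k)))).
Qed.

Let hausT : hausdorff_space (TS (X := X) S).
Proof. by apply: (@hausdorff_product _ (fun k : {k | k \in S} => X (sval k))). Qed.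

(* The projection of a conull Borel set need not be Borel; by inner regularity
   it contains a countable union of projections of compact sets, which is
   Borel and conull. *)
Lemma conull_projection (lam : probability PY R) : lam [set x | 0 < s x] = 0%E ->
  exists M : set (PS X S), [/\ measurable M, lam (pS @^-1` (~` M)) = 0%E &
    forall y, M y -> cS c phi S y = (PhiS y)%:E].
Proof.
move=> s0; set Z : set PY := [set x | 0 < s x].
have mZ : measurable Z by exact: measurable_pos_slack sepX mu c c_lsc phi phi_int.
have e0 (n : nat) : 0 < n.+1%:R^-1 :> R by [].
have /choice[K hK] := fun n =>
  PS_inner_compact sepX [set: 'I_N]%SET lam (~` Z) _ (measurableC mZ) (e0 n).
pose pK n : set (PS X S) := [set pS x | x in K n].
(* A continuous image of a compact set is compact, hence closed in the Hausdorff product. *)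
have mpK n : measurable (pK n).
  have [cK _ _ _] := hK n.
  apply: (@closed_sigma (TS S) (cylinders X S)); first exact: open_measurable_PS.
  apply: (@compact_closed (TS S)) => //.
  apply: (@continuous_compact TY (TS S)) cK.
  by apply: continuous_subspaceT; exact: continuous_prj.
exists (\bigcup_n pK n); split.
- exact: bigcupT_measurable.
- apply/eqP; rewrite eq_le measure_ge0 andbT; apply/lee_addgt0Pr => e ep.
  have [n] := ltr_add_invr ep; rewrite !add0r => ne.
  have [cK mK KZ Ke] := hK n.
  apply: (@le_trans _ _ (lam (Z `|` (~` Z `\` K n)))).
    apply: le_measure; rewrite ?inE.
    + by rewrite -[X in measurable X]setTI; apply: measurable_pprj => //;
        apply: measurableC; exact: bigcupT_measurable.
    + by apply: measurableU => //; apply: measurableD => //; exact: measurableC.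
    + move=> x nM; have [Zx|nZx] := pselect (Z x); first by left.
      by right; split => // Kx; apply: nM; exists n => //; exists x.
  apply: (@le_trans _ _ (lam Z + lam (~` Z `\` K n))%E).
    apply: measureU2 => //.
    by apply: measurableD => //; exact: measurableC.
  rewrite (s0 : lam Z = 0%E) !add0e -[leLHS]fineK ?lee_fin.
    by apply: le_trans Ke _; exact: ltW.
  by apply: fin_num_measure; apply: measurableD => //; exact: measurableC.
- move=> y [n _ [x Kx <-]]; apply: cS_prj; rewrite leNgt; apply/negP.
  by have [_ _ KZ _] := hK n; exact: KZ Kx.
Qed.

(** The integral of [PhiS] is the same for all couplings and bounds the reduced cost from below; for
    the projected plan the bound is attained, as [cS] equals [PhiS] on a conull set. *)
Lemma slack_null_optimal_RMKP (lam : probability PY R) : coupling mu lam ->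
  lam [set x | 0 < s x] = 0%E ->
  optimal_RMKP mu c phi (law lam pS (measurable_pprj _ _ _)).
Proof.
move=> clam s0; set tau := law _ _ _.
have ctau : coupling mu tau by exact: coupling_law.
split => // tau' ctau'.
have tot (t : probability (PS X S) R) : coupling mu t -> (\int[t]_y (PhiS y)%:E =
    \sum_(k : {k | k \in S}) \int[mu (sval k)]_x (phi (sval k) x)%:E)%E.
  exact: potential_sum_integral.
apply: (@le_trans _ _ (\int[tau]_y (PhiS y)%:E)%E); last first.
  by rewrite tot// -(tot tau')//; apply: le_integral_total => y; exact: cS_ge.
have [M [mM M0 cM]] := conull_projection lam s0.
(* A measurable majorant of [cS] that equals [PhiS] almost everywhere, so that almost-everywhere
   equality of integrals can be used. *)
pose Psi (y : PS X S) : \bar R := if y \in M then (PhiS y)%:E else +oo%E.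
apply: (@le_trans _ _ (\int[tau]_y Psi y)%E).
  apply: le_integral_total => y; rewrite /Psi.
  by case: ifPn => [/set_mem/cM->//|_]; exact: leey.
have mPhi : measurable_fun setT (fun y : PS X S => (PhiS y)%:E).
  exact: (measurable_int _ (potential_sum_integrable mu phi phi_int _ _ ctau)).
rewrite (@ae_eq_integral _ _ _ tau setT (fun y => (PhiS y)%:E) Psi)//.
  apply: measurable_fun_ifT => //.
  apply: (measurable_fun_bool true); rewrite setTI.
  rewrite (_ : _ @^-1` _ = M)//; apply/seteqP.
  by split => y /=; [exact: set_mem|exact: mem_set].
exists (~` M); split => //; first exact: measurableC.
move=> y /= nPsi My; apply: nPsi => _; rewrite /Psi.
by case: ifPn => //; rewrite notin_setE.
Qed.

End reduced_problem.

(** * Graphs over the coordinates in P *)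

Lemma eq_measure_mod_null {d} {T : measurableType d} {R : realType}
    (P : {measure set T -> \bar R}) (A B D : set T) :
  measurable A -> measurable B -> measurable D -> P D = 0%E ->
  A `\` B `<=` D -> B `\` A `<=` D -> P A = P B.
Proof.
move=> mA mB mD D0 AB BA.
have le E F : measurable E -> measurable F -> E `\` F `<=` D -> (P E <= P F)%E.
  move=> mE mF EF; rewrite -[P F]adde0 -D0.
  apply: (@le_trans _ _ (P (F `|` D))); last exact: measureU2.
  apply: le_measure; rewrite ?inE//; first exact: measurableU.
  by move=> x Ex; have [Fx|nFx] := pselect (F x); [left|right; exact: EF].
by apply/eqP; rewrite eq_le !le.
Qed.

Lemma measurable_forall {d} {T : measurableType d} (I : finType) (A : I -> set T) :
  (forall i, measurable (A i)) -> measurable [set x | forall i, A i x].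
Proof.
move=> mA; rewrite (_ : mkset _ = \big[setI/setT]_i A i).
  by apply: bigsetI_measurable.
rewrite -bigcap_seq; apply/seteqP; split=> [x Ax i _|x xA i]; first exact: Ax.
by apply: xA => /=; exact: mem_index_enum.
Qed.

Section mismatch.
Context {R : realType} {N : nat} {X : 'I_N -> completePseudoMetricType R}.
Variables (P J : {set 'I_N}).

(* The complement of [z_J = T z_P], seen through the test set [F]; this avoids
   the measurability of the diagonal. *)
Definition mismatch (T : PS X P -> PS X J) (F : set (PS X J)) :
    set (PS X (J :|: P)) :=
  [set w | ~ (F (pprj (finset.subsetUl J P) w) <->
              F (T (pprj (finset.subsetUr J P) w)))].

Lemma measurable_mismatch T F : measurable_fun setT T -> measurable F ->
  measurable (mismatch T F).
Proof.
move=> mT mF.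
pose A : set (PS X (J :|: P)) := [set w | F (pprj (finset.subsetUl J P) w)].
pose B : set (PS X (J :|: P)) := [set w | F (T (pprj (finset.subsetUr J P) w))].
have mA : measurable A by rewrite -[A]setTI; exact: measurable_pprj.
have mB : measurable B.
  rewrite -[B]setTI.
  by apply: (measurableT_comp mT (measurable_pprj _ _ (finset.subsetUr J P))).
rewrite (_ : mismatch T F = (A `\` B) `|` (B `\` A)); last first.
  apply/seteqP; split => [w mis|w [[Aw nBw]|[Bw nAw]]]; last 2 first.
  - by move=> [/(_ Aw)].
  - by move=> [_ /(_ Bw)].
  have [Aw|nAw] := pselect (A w).
    by left; split => // Bw; apply: mis.
  by right; split => //; apply: contrapT => nBw; apply: mis; split.
by apply: measurableU; exact: measurableD.
Qed.

(** A point glued from [x] and [T x] never mismatches, so the preimage of the event is empty.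
    Disjointness keeps [x] from overwriting coordinates of [T x]. *)
Lemma mismatch_null (tau : probability (PS X (J :|: P)) R) T F :
  [disjoint J & P]%B -> measurable_fun setT T -> measurable F ->
  meq tau (pushforward (pushforward tau (pprj (finset.subsetUr J P)))
             (fun x => pglue (sub_setUC J P) x (T x))) ->
  tau (mismatch T F) = 0%E.
Proof.
move=> JP mT mF /(_ _ (measurable_mismatch T F mT mF)) ->.
rewrite /pushforward -[RHS](measure0 tau); congr (tau _).
rewrite -subset0 => w; rewrite /preimage /mismatch /=.
set x := pprj _ w; apply.
have -> : pprj (finset.subsetUr J P) (pglue (sub_setUC J P) x (T x)) = x.
  apply: prodS_ext => -[k kP]; have kJP := fintype.subsetP (finset.subsetUr J P) _ kP.
  by rewrite /pprj (prjE _ _ _ kP kJP) /pglue (glue_l _ _ _ _ kJP kP).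
have -> : pprj (finset.subsetUl J P) (pglue (sub_setUC J P) x (T x)) = T x.
  apply: prodS_ext => -[k kJ]; have kJP := fintype.subsetP (finset.subsetUl J P) _ kJ.
  rewrite /pprj (prjE _ _ _ kJ kJP) /pglue (glue_r _ _ _ _ kJP kJ)//.
  by apply: contraTN kJ => kP; rewrite (disjointFl JP kP).
by [].
Qed.

End mismatch.

Lemma prj_prj {N : nat} {X : 'I_N -> Type} {S T U : {set 'I_N}} (hST : S \subset T)
  (hTU : T \subset U) (hSU : S \subset U) (z : prodS X U) :
  prj hST (prj hTU z) = prj hSU z.
Proof.
apply: prodS_ext => -[k kS]; have kT := fintype.subsetP hST _ kS.
have kU := fintype.subsetP hTU _ kT.
by rewrite (prjE _ _ _ kS kT) (prjE _ _ _ kT kU) (prjE _ _ _ kS kU).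
Qed.

Section conditional_graphs.
Context {R : realType} {N : nat} {X : 'I_N -> completePseudoMetricType R}.
Variables (P Q : {set 'I_N}) (Qs : {set {set 'I_N}}).
Hypothesis hQs : finset.partition Qs (~: (Q :|: P)).

Local Notation PY := (PS X [set: 'I_N]%SET).
Local Notation p S := (@pprj N (fun k => X k) S [set: 'I_N]%SET (finset.subsetT S)).
Local Notation lawS lam S := (law lam (p S) (measurable_pprj _ _ _)).

Lemma block_disjoint Qj : Qj \in Qs -> [disjoint Qj & P]%B.
Proof.
move=> QjQs; rewrite finset.disjoints_subset.
apply: (@fintype.subset_trans _ _ (mem (~: (Q :|: P)))).
  by rewrite -(finset.cover_partition hQs); exact: finset.bigcup_sup.
by rewrite finset.setCS finset.subsetUr.
Qed.

(** The family [F] is indexed by all subsets of the index set, which avoids dependent indexing; only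
    the blocks in [Qs] constrain [z]. *)
Definition rectangle (E : set (PS X P)) (F : forall Qj, set (PS X Qj))
    (G : set (PS X Q)) : set PY :=
  p P @^-1` E `&` [set z | forall Qj, Qj \in Qs -> F Qj (p Qj z)] `&` p Q @^-1` G.

(** What the block conditions of [rectangle] become when each block of coordinates is replaced by
    its image under [T]. *)
Definition graph_part (T : forall Qj, PS X P -> PS X Qj)
    (F : forall Qj, set (PS X Qj)) : set (PS X P) :=
  [set x | forall Qj, Qj \in Qs -> F Qj (T Qj x)].

Definition base_set (E : set (PS X P)) (G : set (PS X Q)) : set (PS X (Q :|: P)) :=
  pprj (finset.subsetUr Q P) @^-1` E `&` pprj (finset.subsetUl Q P) @^-1` G.

Let measurable_p S (A : set (PS X S)) : measurable A -> measurable (p S @^-1` A).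
Proof. by move=> mA; rewrite -[X in measurable X]setTI; exact: measurable_pprj. Qed.

Lemma measurable_base_set E G : measurable E -> measurable G ->
  measurable (base_set E G).
Proof.
move=> mE mG; apply: measurableI; rewrite -[X in measurable X]setTI;
  exact: measurable_pprj.
Qed.

Let measurable_blocks {d} {U : measurableType d} (A : forall Qj : {set 'I_N}, set U) :
  (forall Qj, Qj \in Qs -> measurable (A Qj)) ->
  measurable [set z | forall Qj, Qj \in Qs -> A Qj z].
Proof.
move=> mA; apply: (measurable_forall _ (fun Qj => [set z | Qj \in Qs -> A Qj z])) => Qj.
have [QjQs|nQj] := boolP (Qj \in Qs).
  rewrite (_ : mkset _ = A Qj); first exact: mA.
  by apply/seteqP; split => z /=; [apply|].
by rewrite (_ : mkset _ = setT)//; apply/seteqP; split => z.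
Qed.

Lemma measurable_rectangle E F G : measurable E ->
  (forall Qj, Qj \in Qs -> measurable (F Qj)) -> measurable G ->
  measurable (rectangle E F G).
Proof.
move=> mE mF mG; apply: measurableI; last exact: measurable_p.
apply: measurableI; first exact: measurable_p.
by apply: measurable_blocks => Qj QjQs; apply: measurable_p; exact: mF.
Qed.

Lemma measurable_graph_part T F :
  (forall Qj, Qj \in Qs -> measurable_fun setT (T Qj)) ->
  (forall Qj, Qj \in Qs -> measurable (F Qj)) -> measurable (graph_part T F).
Proof.
move=> mT mF; apply: measurable_blocks => Qj QjQs.
rewrite -[X in measurable X]setTI.
exact: (mT _ QjQs measurableT _ (mF _ QjQs)).
Qed.

(** Testing [F Qj] on [T Qj] of the [P]-coordinates instead of on the block changes the event only
    inside the finite union of mismatches, which is null. The mass of a rectangle is thus read off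
    the projection to [Q :|: P]. *)
Lemma rectangle_base (lam : probability PY R) T E F G :
  (forall Qj, Qj \in Qs -> measurable_fun setT (T Qj)) ->
  measurable E -> (forall Qj, Qj \in Qs -> measurable (F Qj)) -> measurable G ->
  (forall Qj, Qj \in Qs -> lawS lam (Qj :|: P) (mismatch P Qj (T Qj) (F Qj)) = 0%E) ->
  lam (rectangle E F G) =
  lawS lam (Q :|: P) (base_set (E `&` graph_part T F) G).
Proof.
move=> mT mE mF mG mis0.
have mgr := measurable_graph_part T F mT mF.
have -> : lawS lam (Q :|: P) (base_set (E `&` graph_part T F) G) =
    lam (p P @^-1` (E `&` graph_part T F) `&` p Q @^-1` G).
  rewrite lawE; congr (lam _); apply/seteqP; split => z /=;
    by rewrite /base_set /= /pprj !(prj_prj _ _ (finset.subsetT _)).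
pose D (Qj : {set 'I_N}) : set PY :=
  if Qj \in Qs then p (Qj :|: P) @^-1` mismatch P Qj (T Qj) (F Qj) else set0.
have mD Qj : measurable (D Qj).
  rewrite /D; case: ifPn => // QjQs; apply: measurable_p.
  by apply: measurable_mismatch; [exact: mT|exact: mF].
have mDD : measurable (\big[setU/set0]_Qj D Qj) by exact: bigsetU_measurable.
have DD0 : lam (\big[setU/set0]_Qj D Qj) = 0%E.
  apply/eqP; rewrite eq_le measure_ge0 andbT.
  apply: le_trans (measure_bigsetU_le lam _ _ mD) _.
  rewrite big1// => Qj _; rewrite /D; case: ifPn => [QjQs|_]; last exact: measure0.
  exact: mis0.
have inD Qj z : Qj \in Qs -> ~ (F Qj (p Qj z) <-> F Qj (T Qj (p P z))) ->
    (\big[setU/set0]_Qj D Qj) z.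
  move=> QjQs nF; rewrite -bigcup_seq; exists Qj; first by rewrite /= mem_index_enum.
  by rewrite /D QjQs /mismatch /= /pprj !(prj_prj _ _ (finset.subsetT _)).
apply: (eq_measure_mod_null lam _ _ _ _ _ mDD DD0).
- exact: measurable_rectangle.
- by apply: measurableI; apply: measurable_p => //; exact: measurableI.
- move=> z [[[Ez Fz] Gz]] nz; apply: contrapT => nD; apply: nz.
  split => //; split => // Qj QjQs; apply: contrapT => nF; apply: nD.
  by apply: (inD _ _ QjQs) => -[/(_ (Fz _ QjQs))].
- move=> z [[[Ez Fz] Gz]] nz; apply: contrapT => nD; apply: nz.
  split => //; split => // Qj QjQs; apply: contrapT => nF; apply: nD.
  by apply: (inD _ _ QjQs) => -[_ /(_ (Fz _ QjQs))].
Qed.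

(** The product of Dirac masses is the indicator of [graph_part]. *)
Lemma rectangle_disintegration (lamP : probability (PS X P) R)
    (kappa : R.-pker (PS X P) ~> (PS X Q)) T E F G :
  (\int[lamP]_(x in E `&` graph_part T F) kappa x G =
   \int[lamP]_(x in E)
     ((\prod_(Qj in Qs) @dirac _ _ (T Qj x) R (F Qj)) * kappa x G))%E.
Proof.
rewrite integral_mkcondr; apply: eq_integral => x _; rewrite patchE.
case: ifPn => [/set_mem grx|].
  rewrite big1 ?mul1e// => Qj QjQs; rewrite diracE mem_set//; exact: grx.
rewrite notin_setE => /existsNP[Qj /not_implyP[QjQs nF]].
by rewrite (bigD1 Qj)//= diracE memNset// mul0e mul0e.
Qed.

(** Dynkin uniqueness: rectangles are stable under intersection, and every coordinate cylinder is a
    rectangle because [P], [Q] and the blocks cover all indices. *)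
Lemma eq_rectangles (lam lam' : probability PY R) :
  (forall E F G, measurable E -> (forall Qj, Qj \in Qs -> measurable (F Qj)) ->
    measurable G -> lam (rectangle E F G) = lam' (rectangle E F G)) ->
  meq lam lam'.
Proof.
move=> hrect.
pose B : set (set PY) := [set A | exists E F G, [/\ measurable E,
  forall Qj, Qj \in Qs -> measurable (F Qj), measurable G & A = rectangle E F G]].
have rT : rectangle setT (fun=> setT) setT = setT.
  by apply/seteqP; split => // z _; split => //; split.
move=> A mA; apply: (measure_unique B (fun=> setT)) => //.
- apply/seteqP; split.
    apply: sub_sigma_algebra2 => _ [k [C [mC ->]]].
    (* The condition on coordinate [k] if [S] contains [k], and the whole space otherwise; one
       formula serves all blocks. *)
    pose cyl S : set (PS X S) := fun x : PS X S =>
      forall kS : sval k \in S, C (x (exist _ (sval k) kS)).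
    have mcyl S : measurable (cyl S).
      have [kS|nkS] := boolP (sval k \in S); last first.
        rewrite (_ : cyl S = setT)//; apply/seteqP; split => // x _ kS.
        by rewrite kS in nkS.
      rewrite (_ : cyl S = (fun x : PS X S => x (exist _ (sval k) kS)) @^-1` C).
        exact: (measurable_coord S (exist _ (sval k) kS)).
      apply/seteqP; split => x /= xC; first exact: xC.
      by move=> kS'; rewrite (bool_irrelevance kS' kS).
    exists (cyl P), cyl, (cyl Q); split => //.
    have pk (S : {set 'I_N}) (z : PY) (kS : sval k \in S) : p S z (exist _ (sval k) kS) = z k.
      by case: k kS {cyl mcyl mC C} => k kT /= kS; exact: prjE.
    apply/seteqP; split => [z Cz|z [[Pz Fz] Qz]].
      by split; [split|] => [kS|Qj _ kS|kS]; rewrite pk.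
    have [kP|nkP] := boolP (sval k \in P); first by have := Pz kP; rewrite pk.
    have [kQ|nkQ] := boolP (sval k \in Q); first by have := Qz kQ; rewrite pk.
    have : sval k \in finset.cover Qs.
      by rewrite (finset.cover_partition hQs) !inE negb_or nkQ.
    by move=> /finset.bigcupP[Qj QjQs kQj]; have := Fz _ QjQs kQj; rewrite pk.
  apply: smallest_sub; first exact: sigma_algebra_measurable.
  by move=> _ [E [F [G [mE mF mG ->]]]]; exact: measurable_rectangle.
- move=> _ _ [E [F [G [mE mF mG ->]]]] [E' [F' [G' [mE' mF' mG' ->]]]].
  exists (E `&` E'), (fun Qj => F Qj `&` F' Qj), (G `&` G'); split.
  + exact: measurableI.
  + by move=> Qj QjQs; apply: measurableI; [exact: mF|exact: mF'].
  + exact: measurableI.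
  + apply/seteqP; split => [z [[[Ez Fz] Gz] [[Ez' Fz'] Gz']]|z [[[Ez Ez'] Fz] [Gz Gz']]].
      by split; [split|] => // Qj QjQs; split; [exact: Fz|exact: Fz'].
    by split; (split; [split|]) => // Qj QjQs; case: (Fz _ QjQs).
- by move=> _; exists setT, (fun=> setT), setT; split => //; rewrite rT.
- by apply/seteqP; split => // z _; exists 0%N.
- by move=> _ [E [F [G [mE mF mG ->]]]]; exact: hrect.
- move=> _; apply: (@le_lt_trans _ _ 1%E); last exact: ltry.
  exact: (@probability_le1 _ PY R lam setT measurableT).
Qed.

End conditional_graphs.

(** * Structure and uniqueness of optimal plans *)

Theorem mainTheorem5
  (R : realType) (N : nat) (hN : (3 <= N)%N)
  (X : 'I_N -> completePseudoMetricType R)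
  (X_polish : forall k, hausdorff_space (X k) /\ separable_space (X k))
  (mu : forall k : 'I_N, probability (borel (X k)) R)
  (c : prodS X [set: 'I_N]%SET -> R)
  (c_lsc : lower_semicontinuous
     (fun x : prod_topology (fun k : sidx [set: 'I_N]%SET => X (sval k)) =>
        (c x)%:E))
  (a : forall k : 'I_N, X k -> R)
  (a_int : forall k, (mu k).-integrable setT (EFin \o a k))
  (c_lb : forall x, \sum_(k < N) a k (xcoord x k) <= c x)
  (MKP_attained : exists lam, optimal_MKP mu c lam)
  (phi : forall k : 'I_N, X k -> R)
  (phi_int : forall k, (mu k).-integrable setT (EFin \o phi k))
  (phi_adm : forall x, \sum_(k < N) phi k (xcoord x k) <= c x)
  (phi_opt : forall psi : forall k : 'I_N, X k -> R,
     (forall k, (mu k).-integrable setT (EFin \o psi k)) ->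
     (forall x, \sum_(k < N) psi k (xcoord x k) <= c x) ->
     (\sum_(k < N) \int[mu k]_x (psi k x)%:E
        <= \sum_(k < N) \int[mu k]_x (phi k x)%:E)%E)
  (P Q : {set 'I_N})
  (hP : P \proper [set: 'I_N]%SET)
  (hQ0 : Q != finset.set0)
  (hQ : Q \proper ~: P)
  (Qs : {set {set 'I_N}})
  (hQs : finset.partition Qs (~: (Q :|: P)))
  (graph : forall Qj, Qj \in Qs ->
     forall tau : probability (PS X (Qj :|: P)) R,
       optimal_RMKP mu c phi tau ->
       exists Tj : PS X P -> PS X Qj,
         measurable_fun setT Tj /\
         meq tau (pushforward (pushforward tau (pprj (finset.subsetUr Qj P)))
                    (fun x => pglue (sub_setUC Qj P) x (Tj x)))) :
  (forall lam : probability (PS X [set: 'I_N]%SET) R,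
   optimal_MKP mu c lam ->
   forall lamP : probability (PS X P) R,
   meq lamP (pushforward lam (pprj (finset.subsetT P))) ->
   forall lamR : probability (PS X (Q :|: P)) R,
   meq lamR (pushforward lam (pprj (finset.subsetT (Q :|: P)))) ->
   forall kappa : R.-pker (PS X P) ~> (PS X Q),
   (forall (E : set (PS X P)) (F : set (PS X Q)),
      measurable E -> measurable F ->
      lamR (pprj (finset.subsetUr Q P) @^-1` E `&` pprj (finset.subsetUl Q P) @^-1` F)
        = \int[lamP]_(x in E) kappa x F)%E ->
   exists T : forall Qj : {set 'I_N}, PS X P -> PS X Qj,
     (forall Qj, Qj \in Qs -> measurable_fun setT (T Qj)) /\
     forall (E : set (PS X P)) (F : forall Qj : {set 'I_N}, set (PS X Qj))
            (G : set (PS X Q)),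
       measurable E -> (forall Qj, Qj \in Qs -> measurable (F Qj)) ->
       measurable G ->
       (lam (pprj (finset.subsetT P) @^-1` E
            `&` [set z | forall Qj, Qj \in Qs -> F Qj (pprj (finset.subsetT Qj) z)]
            `&` pprj (finset.subsetT Q) @^-1` G)
       = \int[lamP]_(x in E)
           ((\prod_(Qj in Qs) @dirac _ _ (T Qj x) R (F Qj)) * kappa x G))%E)
  /\
  (unique_RMKP mu c phi (Q :|: P) ->
   (forall Qj, Qj \in Qs -> unique_RMKP mu c phi (Qj :|: P)) ->
   exists lam : probability (PS X [set: 'I_N]%SET) R,
     optimal_MKP mu c lam /\
     forall lam', optimal_MKP mu c lam' -> meq lam lam').
Proof.
have sepX k := (X_polish k).2; have hausX k := (X_polish k).1.
have N0 : (0 < N)%N by exact: leq_trans hN.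
(* The reference coupling that forces zero slack on every optimal plan. *)
have [lam0 [clam0 s0]] :=
  zero_slack_coupling sepX mu c c_lsc phi phi_int N0 phi_adm phi_opt.
have opt_slack lam : optimal_MKP mu c lam -> lam [set x | 0 < slack c phi x] = 0%E.
  exact: optimal_slack_null sepX mu c c_lsc phi phi_int phi_adm lam0 lam clam0 s0.
pose lawS (lam : probability (PS X [set: 'I_N]%SET) R) S : probability (PS X S) R :=
  law lam (pprj (finset.subsetT S)) (measurable_pprj _ _ _).
have opt_law lam S : optimal_MKP mu c lam -> optimal_RMKP mu c phi (lawS lam S).
  move=> lam_opt; apply: slack_null_optimal_RMKP => //; first exact: lam_opt.1.
  exact: opt_slack.
have graphs lam : optimal_MKP mu c lam ->
    exists T : forall Qj : {set 'I_N}, PS X P -> PS X Qj,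
      (forall Qj, Qj \in Qs -> measurable_fun setT (T Qj)) /\
      (forall Qj F, Qj \in Qs -> measurable F ->
        lawS lam (Qj :|: P) (mismatch P Qj (T Qj) F) = 0%E).
  move=> lam_opt.
  (* Subsets outside [Qs] receive a constant map, so that [T] is defined on all of them. *)
  have hT Qj : exists Tj : PS X P -> PS X Qj, Qj \in Qs ->
      measurable_fun setT Tj /\
      forall F, measurable F -> lawS lam (Qj :|: P) (mismatch P Qj Tj F) = 0%E.
    have [QjQs|nQj] := boolP (Qj \in Qs); last by exists (fun=> point).
    have [Tj [mTj hTj]] := graph _ QjQs _ (opt_law _ (Qj :|: P) lam_opt).
    exists Tj => _; split => // F mF; apply: mismatch_null => //.
    exact: (block_disjoint P Q Qs hQs).
  exists (fun Qj => sval (cid (hT Qj))); split => [Qj QjQs|Qj F QjQs mF].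
    by case: (cid (hT Qj)) => Tj /= /(_ QjQs)[].
  by case: (cid (hT Qj)) => Tj /= /(_ QjQs)[_]; exact.
split.
  move=> lam lam_opt lamP lamPE lamR lamRE kappa kappaE.
  have [T [mT misT]] := graphs _ lam_opt; exists T; split => // E F G mE mF mG.
  have mgr := measurable_graph_part P Qs T F mT mF.
  have mis0 Qj : Qj \in Qs -> lawS lam (Qj :|: P) (mismatch P Qj (T Qj) (F Qj)) = 0%E.
    by move=> QjQs; apply: misT => //; exact: mF.
  have := rectangle_base P Q Qs lam T E F G mT mE mF mG mis0.
  rewrite /rectangle => ->; rewrite -rectangle_disintegration.
  (* The graph condition is absorbed into the [P]-event, to which the given disintegration
     applies. *)
  transitivity (lamR (base_set P Q (E `&` graph_part P Qs T F) G)).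
    by apply/esym; apply: lamRE; apply: measurable_base_set => //; exact: measurableI.
  by apply: kappaE => //; exact: measurableI.
move=> [tauR [_ tauR_uniq]] uniqQ; have [lam lam_opt] := MKP_attained.
exists lam; split => // lam' lam'_opt; apply: (eq_rectangles P Q Qs hQs).
move=> E F G mE mF mG; have [T [mT misT]] := graphs _ lam_opt.
have mgr := measurable_graph_part P Qs T F mT mF.
have mis0 Qj : Qj \in Qs -> lawS lam (Qj :|: P) (mismatch P Qj (T Qj) (F Qj)) = 0%E.
  by move=> QjQs; apply: misT => //; exact: mF.
(* The maps found for [lam] also serve [lam']: uniqueness identifies the two projections to
   [Qj :|: P]. *)
have mis0' Qj : Qj \in Qs -> lawS lam' (Qj :|: P) (mismatch P Qj (T Qj) (F Qj)) = 0%E.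
  move=> QjQs; have [tauj [_ tauj_uniq]] := uniqQ _ QjQs.
  have mmis : measurable (mismatch P Qj (T Qj) (F Qj)).
    by apply: measurable_mismatch; [exact: mT|exact: mF].
  rewrite -(tauj_uniq _ (opt_law _ (Qj :|: P) lam'_opt) _ mmis).
  by rewrite (tauj_uniq _ (opt_law _ (Qj :|: P) lam_opt) _ mmis) mis0.
rewrite (rectangle_base P Q Qs lam T E F G mT mE mF mG mis0).
rewrite (rectangle_base P Q Qs lam' T E F G mT mE mF mG mis0').
have mbase : measurable (base_set P Q (E `&` graph_part P Qs T F) G).
  by apply: measurable_base_set => //; exact: measurableI.
by rewrite -(tauR_uniq _ (opt_law _ (Q :|: P) lam_opt) _ mbase)
  (tauR_uniq _ (opt_law _ (Q :|: P) lam'_opt) _ mbase).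
Qed.
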